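(* Let $d\ge1$, and let $\beta_2>0$ be a constant depending only on $d$ for which there is $n_1\ge3$ (depending on $d$) such that for all odd $n\ge n_1$ and $t\ge4d$, $$G(t)\le\frac{\beta_2}{t^{\frac d2+2}\wedge n^{d+4}}\exp\left(-2\gamma^{(1)}_1d^{-1}t\right),$$ where $G$ is defined in the context (such a $\beta_2$ exists). For odd $n\geq 3$ let $\mathbf{Y}=\mathbf{Y}^{(\mathbf{0})}$ be the smoothing process on $\mathbb{T}_n^d=(\mathbb{Z}/n\mathbb{Z})^d$ associated with simple random walk, started from unit mass at $\mathbf{0}$ and zero mass elsewhere. There exist positive constants $\theta_1,\theta_2$ and $n_0\ge3$ (all depending on $d$) such that for all odd $n\ge n_0$ and $t\ge4d$, $$\frac{\theta_1}{t^{\frac d2+2}\wedge n^{d+4}}\exp\left(-2\gamma^{(1)}_1d^{-1}t\right)\le\mathbb{E}\sum_{\mathbf{i}\in\mathbb{T}_n^d}\Delta_{\mathbf{i}}^2(t)\le\frac{\theta_2}{t^{\frac d2+2}\wedge n^{d+4}}\exp\left(-\left(2\gamma^{(1)}_1d^{-1}-\frac{4\beta_2}{n^{d+4}}\right)t\right).$$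
   Context: $a\wedge b=\min(a,b)$ and $\gamma^{(1)}_1=1-\cos(2\pi/n)$. Vertices $\mathbf{i},\mathbf{j}\in\mathbb{T}_n^d$ are neighbors ($\mathbf{i}\sim\mathbf{j}$) if they differ by $\pm1$ (mod $n$) in exactly one coordinate and agree in the others. Smoothing process on $\mathbb{T}_n^d$: each site carries a unit-intensity Poisson process (clock); all clocks are jointly independent and independent of $\mathbf{Y}(0)$. When the clock at $\mathbf{k}$ rings at time $t$, the value at $\mathbf{k}$ becomes $Y_{\mathbf{k}}(t)=\frac{1}{2d}\sum_{\mathbf{j}\sim\mathbf{k}}Y_{\mathbf{j}}(t-)$ and all other values remain unchanged. Set $\Delta_{\mathbf{i}}(t)=\frac{1}{2d}\sum_{\mathbf{j}\sim\mathbf{i}}Y_{\mathbf{j}}(t)-Y_{\mathbf{i}}(t)$. For $F:\mathbb{R}_+\times\mathbb{T}_n^d\to\mathbb{R}$ let $(\Delta F)(t,\mathbf{i})=\frac{1}{2d}\sum_{\mathbf{j}\sim\mathbf{i}}F(t,\mathbf{j})-F(t,\mathbf{i})$. Let $p(t,\mathbf{i})$ be the heat kernel of the continuous-time (rate 1) simple random walk on $\mathbb{T}_n^d$ started at $\mathbf{0}$, i.e. the solution of $\partial_tp=\Delta p$ with $p(0,\mathbf{i})=\mathbf{1}_{\{\mathbf{i}=\mathbf{0}\}}$, and let $G(t)=\sum_{\mathbf{i}\in\mathbb{T}_n^d}(\Delta p(t,\mathbf{i}))^2$. *)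

(* Defs.v *)
From HB Require Import structures.
From mathcomp Require Import all_boot all_order all_algebra.
From mathcomp Require Import all_classical all_reals all_analysis.

Set Implicit Arguments.
Unset Strict Implicit.
Unset Printing Implicit Defensive.

Import Order.TTheory GRing.Theory Num.Theory.
Import numFieldNormedType.Exports.

Local Open Scope classical_set_scope.
Local Open Scope ring_scope.

(* 'Z_n is the ring of integers mod n only for n >= 2. *)
Definition torus (d n : nat) := {ffun 'I_d -> 'Z_n}.

Definition neighbors (d n : nat) (i j : torus d n) : bool :=
  [exists k, ((j k == i k + 1) || (j k == i k - 1)) &&
             [forall l, (l != k) ==> (j l == i l)]].

Section SpatialOperators.
Context {R : realType} {d n : nat}.
Implicit Types (f : torus d n -> R) (i : torus d n).

Definition nbr_avg f i : R :=
  (2 * d%:R)^-1 * \sum_(j : torus d n | neighbors i j) f j.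

Definition laplacian f i : R := nbr_avg f i - f i.

(* Only times t >= 0 are constrained.  Right continuity at 0 ties the
   differential equation, imposed for t > 0, to the initial condition. *)
Definition is_heat_kernel (p : R -> torus d n -> R) : Prop :=
  forall i,
    [/\ p 0 i = (i == 0)%:R,
        p u i @[u --> 0^'+] --> p 0 i
      & forall t : R, 0 < t ->
          is_derive t 1 (fun u => p u i) (laplacian (p t) i)].

Definition heat_energy (p : R -> torus d n -> R) (t : R) : R :=
  \sum_(i : torus d n) laplacian (p t) i ^+ 2.

End SpatialOperators.

Definition gap1 {R : realType} (n : nat) : R := 1 - cos (2 * pi / n%:R).

Section Probability.
Context {R : realType} {dT : measure_display} {T : measurableType dT}
  (P : probability T R).

(* Used with sub-sigma-algebras F i. *)
Definition mutually_independent (I : finType) (F : I -> set_system T) : Prop :=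
  forall (J : {set I}) (A : I -> set T), (forall i, i \in J -> F i (A i)) ->
    P (\bigcap_(i in [set` J]) A i) = (\prod_(i in J) P (A i))%E.

Definition generated_sigma (S : Type) (D : set S) (dE : measure_display)
    (E : measurableType dE) (X : S -> T -> E) : set_system T :=
  <<s \bigcup_(s in D) preimage_set_system setT (X s) measurable >>.

(* A unit-intensity Poisson process on [0, +oo[, given by its counting
   function; the values at negative times are irrelevant.  Truncated
   subtraction is harmless since the paths are nondecreasing a.s. *)
Record poisson_process (N : R -> {RV P >-> nat}) : Prop := PoissonProcess {
  poisson_start : {ae P, forall w, N 0 w = 0%N};
  poisson_nondecreasing : {ae P, forall w,
    forall s t : R, 0 <= s -> s <= t -> (N s w <= N t w)%N};
  poisson_right_continuous : {ae P, forall w,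
    forall t : R, 0 <= t -> \forall u \near t^'+, N u w = N t w};
  poisson_increments_law : forall (s t : R) (m : nat), 0 <= s -> s < t ->
    P [set w | (N t w - N s w)%N = m] = (poisson_pmf (t - s) m)%:E;
  poisson_increments_indep : forall (m : nat) (s : nat -> R), 0 <= s 0%N ->
    (forall i, s i <= s i.+1) ->
    mutually_independent (fun i : 'I_m =>
      preimage_set_system setT (fun w => (N (s i.+1) w - N (s i) w)%N)
        measurable) }.

(* The counting function jumps at time t. *)
Definition rings (N : R -> T -> nat) (t : R) (w : T) : Prop :=
  0 < t /\ forall s : R, 0 <= s -> s < t -> (N s w < N t w)%N.

(* The left limits in [smoothing_ring] exist: Y is locally constant off the
   ring times, which are a.s. locally finite.  Two clocks ring simultaneously
   with probability 0, so the value of Y at such times is immaterial. *)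
Record smoothing_process (d n : nat) (N : torus d n -> R -> {RV P >-> nat})
    (Y : torus d n -> R -> {RV P >-> R}) : Prop := SmoothingProcess {
  smoothing_clocks : forall k, poisson_process (N k);
  smoothing_indep : mutually_independent (fun o : option (torus d n) =>
    if o is Some k
    then generated_sigma [set t : R | 0 <= t] (fun t => N k t : T -> nat)
    else generated_sigma [set: torus d n] (fun k => Y k 0 : T -> R));
  smoothing_ring : {ae P, forall w, forall k (t : R),
    rings (fun u => N k u : T -> nat) t w ->
    Y k t w = nbr_avg (fun j => lim (Y j u w @[u --> t^'-])) k};
  smoothing_const : {ae P, forall w, forall k (s t : R), 0 <= s -> s <= t ->
    (forall u, s < u -> u <= t -> ~ rings (fun v => N k v : T -> nat) u w) ->
    Y k t w = Y k s w} }.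

Definition started_from_unit_mass (d n : nat)
    (Y : torus d n -> R -> {RV P >-> R}) : Prop :=
  {ae P, forall w, forall k, Y k 0 w = (k == 0)%:R}.

Definition discrepancy (d n : nat) (Y : torus d n -> R -> {RV P >-> R})
    (i : torus d n) (t : R) (w : T) : R :=
  laplacian (fun j => Y j t w) i.

End Probability.

(* t^(d/2+2) /\ n^(d+4), with /\ the minimum. *)
Definition decay_scale {R : realType} (d n : nat) (t : R) : R :=
  Num.min (t `^ (d%:R / 2 + 2)) (n%:R ^+ (d + 4)).

(* Main.v *)
Require Import Defs.
From HB Require Import structures.
From mathcomp Require Import all_boot all_order all_algebra.
From mathcomp Require Import all_classical all_reals all_analysis.
From mathcomp Require Import measurable_realfun.
From mathcomp Require Import zify ring lra.

Set Implicit Arguments.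
Unset Strict Implicit.
Unset Printing Implicit Defensive.

Import Order.TTheory GRing.Theory Num.Theory.
Import numFieldNormedType.Exports.

Local Open Scope classical_set_scope.
Local Open Scope ring_scope.

(** Write [L] for the discrete Laplacian, [G] for the heat energy and [H] for the
   expected energy of the process.

   A ring at [k] adds to the value at [k] the discrepancy there, so the matrix [M]
   of second moments solves the closed linear equation
   [M' = L_1 M + L_2 M + diag (L_1 L_2 M)] ([moment_gen]), and [H] is the trace of
   [L_1 L_2 M] ([energy]). Duhamel's formula for the heat flow, the self-adjointness
   of [L] and translation invariance turn this into the renewal equation
   [H(t) = G(t) + int_0^t H(s) G(t - s) ds] ([energy_renewal]).

   The lower bound follows from [H >= G] and a lower bound on [G], obtained by
   testing the heat kernel against products of cosines ([heat_energy_ge]): a whole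
   band of frequencies of order [t ^ (-1/2)] for [t <= n ^ 2]
   ([heat_energy_ge_band]), the slowest mode alone afterwards
   ([heat_energy_ge_gap]).

   For the upper bound, [G] has mass at most [1/2], since twice [G] is the derivative
   of the Dirichlet form ([heat_energy_primitive]). Multiplying the equation by
   [exp (a t)] with [a = 2 gamma / d - 4 beta2 / n ^ (d + 4)] raises the mass of the
   kernel to at most [3/4] plus a small error: the assumed bound on [G] has a part
   of constant size [beta2 / n ^ (d + 4)], whose integral against
   [exp (- 4 beta2 u / n ^ (d + 4))] is [1/4]. The tilted equation is thus still
   subcritical, and, the scale being slowly varying, an argument at the maximum of
   [H exp (a t)] times the scale shows that [H] inherits the decay of [G]
   ([renewal_decay]).

   It remains to see that [H] is the energy attached to the solution [M]
   ([expected_energy]). On a mesh of step [h = t / m], the sets of clocks ringing in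
   the successive intervals are independent random subsets
   ([history_event_probability]). If no two clocks ring in the same interval, which
   fails with probability of order [1 / m], the values at the mesh points are
   obtained by averaging at the clocks that rang ([smooth_path_history]), however
   often they did. The second moments of this finite Markov chain are an Euler
   scheme for the equation of [M] ([chain_energy_converges]), and [m] tends to
   infinity. *)

(** * Derivatives and linear flows *)

Section Calculus.
Context {R : realType}.
Implicit Types (f g : R -> R) (x df dg : R).

Lemma is_derive_add f g x df dg : is_derive x 1 f df -> is_derive x 1 g dg ->
  is_derive x 1 (fun u => f u + g u) (df + dg).
Proof. by move=> hf hg; apply: is_deriveD. Qed.

Lemma is_derive_mul f g x df dg : is_derive x 1 f df -> is_derive x 1 g dg ->
  is_derive x 1 (fun u => f u * g u) (df * g x + f x * dg).
Proof.
move=> hf hg; apply: is_derive_eq.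
by rewrite /GRing.scale /= addrC mulrC.
Qed.

Lemma is_derive_scale f x df c : is_derive x 1 f df ->
  is_derive x 1 (fun u => c * f u) (c * df).
Proof.
move=> hf; have := is_derive_mul (is_derive_cst c x 1) hf.
by rewrite mul0r add0r.
Qed.

Lemma is_derive_bigsum (I : Type) (s : seq I) (F : I -> R -> R) (dF : I -> R) x :
  (forall i, is_derive x 1 (F i) (dF i)) ->
  is_derive x 1 (fun u => \sum_(i <- s) F i u) (\sum_(i <- s) dF i).
Proof.
move=> hF; elim: s => [|i s IH].
  rewrite big_nil (_ : (fun _ => _) = cst 0); first exact: is_derive_cst.
  by apply/funext => u; rewrite big_nil.
rewrite big_cons (_ : (fun _ => _) = fun u => F i u + \sum_(j <- s) F j u).
  exact: is_derive_add.
by apply/funext => u; rewrite big_cons.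
Qed.

Lemma is_derive_reflect f x df t : is_derive (t - x) 1 f df ->
  is_derive x 1 (fun u => f (t - u)) (- df).
Proof.
move=> hf.
have h1 : is_derive x 1 (fun u : R => t - u) (-1).
  have := is_derive_add (is_derive_cst t x 1) (is_deriveNid x 1).
  by rewrite add0r.
have := @is_derive1_comp _ f (fun u => t - u) x _ _ hf h1.
by rewrite mulrN1.
Qed.

Lemma is_derive_continuous f x df : is_derive x 1 f df ->
  {for x, continuous f}.
Proof. by move=> [h _]; apply/differentiable_continuous/derivable1_diffP. Qed.

(** Comparing derivatives replaces the comparison of integrals throughout. *)
Lemma increment_le F G f g (a b : R) : a <= b ->
  (forall x, a <= x <= b -> is_derive x 1 F (f x)) ->
  (forall x, a <= x <= b -> is_derive x 1 G (g x)) ->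
  (forall x, a <= x <= b -> f x <= g x) ->
  F b - F a <= G b - G a.
Proof.
move=> ab hF hG fg.
have hD x : a <= x <= b ->
    is_derive x 1 (fun u => G u + (-1) * F u) (g x + (-1) * f x).
  by move=> hx; apply: is_derive_add; [exact: hG|apply: is_derive_scale; exact: hF].
have [x||c cab /= E] := MVT_segment (f := fun u => G u + (-1) * F u)
    (df := fun x => g x + (-1) * f x) ab.
- by rewrite in_itv/= => /andP[ax xb]; apply: hD; rewrite !ltW.
- apply: derivable_within_continuous => x; rewrite in_itv/= => hx.
  by case: (hD _ hx).
- have {cab} cab : a <= c <= b by move: cab; rewrite in_itv.
  have : 0 <= (g c + -1 * f c) * (b - a).
    by rewrite mulr_ge0 ?subr_ge0 // mulN1r subr_ge0 fg.
  rewrite -E; lra.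
Qed.

Lemma increment_abs_le F f (a b C : R) : a <= b ->
  (forall x, a <= x <= b -> is_derive x 1 F (f x)) ->
  (forall x, a <= x <= b -> `|f x| <= C) ->
  `|F b - F a| <= C * (b - a).
Proof.
move=> ab hF hC.
have hl x : a <= x <= b -> is_derive x 1 (fun u : R => C * u) (C * 1).
  by move=> _; apply: is_derive_scale; exact: is_derive_id.
have hl' x : a <= x <= b -> is_derive x 1 (fun u : R => - C * u) (- C * 1).
  by move=> _; apply: is_derive_scale; exact: is_derive_id.
have u := increment_le ab hF hl.
have l := increment_le ab hl' hF.
rewrite ler_norml; apply/andP; split.
  have : - C * b - - C * a <= F b - F a.
    by apply: l => x hx; rewrite mulr1; move: (hC _ hx); rewrite ler_norml => /andP[].
  lra.
have : F b - F a <= C * b - C * a.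
  by apply: u => x hx; rewrite mulr1; move: (hC _ hx); rewrite ler_norml => /andP[].
lra.
Qed.

End Calculus.

Section Flow.
Context {R : realType} {I : finType}.
Implicit Types (A : (I -> R) -> I -> R) (f g : I -> R).

(** Operators act on plain functions, so linearity is stated pointwise. *)
Definition linop A := forall c f g i,
  A (fun j => c * f j + g j) i = c * A f i + A g i.

Lemma linop0 A i : linop A -> A (fun=> 0) i = 0.
Proof.
move=> lA; have := lA (-1) (fun=> 0) (fun=> 0) i.
rewrite (_ : (fun _ => _) = fun=> 0); last first.
  by apply/funext => j; rewrite mulr0 addr0.
by move=> ->; rewrite mulN1r addNr.
Qed.

Lemma linop_sum A (J : Type) (s : seq J) (c : J -> R) (F : J -> I -> R) i :
  linop A ->
  A (fun k => \sum_(j <- s) c j * F j k) i = \sum_(j <- s) c j * A (F j) i.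
Proof.
move=> lA; elim: s => [|j s IH].
  rewrite big_nil -[RHS](linop0 i lA); congr (A _ i).
  by apply/funext => k; rewrite big_nil.
rewrite big_cons -IH -lA; congr (A _ i).
by apply/funext => k; rewrite big_cons.
Qed.

Lemma linop_matrix A f i : linop A ->
  A f i = \sum_j f j * A (fun k => (k == j)%:R) i.
Proof.
move=> lA; rewrite -(linop_sum _ _ _ _ lA); congr (A _ i).
apply/funext => k; rewrite (bigD1 k) //= eqxx mulr1 big1 ?addr0 // => j jk.
by rewrite eq_sym (negbTE jk) mulr0.
Qed.

Lemma linop_bound A : linop A -> exists2 C : R, 0 <= C &
  forall f (b : R), (forall i, `|f i| <= b) -> forall i, `|A f i| <= C * b.
Proof.
move=> lA; exists (\sum_i \sum_j `|A (fun k => (k == j)%:R) i|).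
  by apply: sumr_ge0 => i _; apply: sumr_ge0.
move=> f b fb i.
have b0 : 0 <= b by apply: le_trans (fb i).
rewrite linop_matrix // (le_trans (ler_norm_sum _ _ _)) // mulr_suml.
rewrite [leRHS](bigD1 i) //= ler_wpDr //.
  by apply: sumr_ge0 => j _; rewrite mulr_ge0 // sumr_ge0.
rewrite mulr_suml ler_sum // => j _.
by rewrite normrM mulrC ler_wpM2l.
Qed.

Lemma iter_linop_bound A (C : R) f (b : R) : 0 <= C ->
  (forall f (b : R), (forall i, `|f i| <= b) -> forall i, `|A f i| <= C * b) ->
  (forall i, `|f i| <= b) ->
  forall k i, `|iter k A f i| <= C ^+ k * b.
Proof.
move=> C0 hC fb; elim=> [|k IH] i; first by rewrite mul1r.
by rewrite exprS -mulrA iterS; apply: hC.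
Qed.

Lemma fun_bounded f : exists2 b : R, 0 <= b & forall i, `|f i| <= b.
Proof.
exists (\sum_i `|f i|); first exact: sumr_ge0.
by move=> i; rewrite (bigD1 i) //= lerDl sumr_ge0.
Qed.

Definition flow A (x : R -> I -> R) :=
  forall (t : R) i, is_derive t 1 (fun u => x u i) (A (x t) i).

Lemma is_derive_linop A B x (t : R) i :
  linop A -> flow B x -> is_derive t 1 (fun u => A (x u) i) (A (B (x t)) i).
Proof.
move=> lA fx; rewrite (linop_matrix _ _ lA).
rewrite (_ : (fun u => _) =
    fun u => \sum_j x u j * A (fun k => (k == j)%:R) i); last first.
  by apply/funext => u; rewrite (linop_matrix _ _ lA).
apply: is_derive_bigsum => j.
have := is_derive_mul (fx t j) (is_derive_cst (A (fun k => (k == j)%:R) i) t 1).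
by rewrite mulr0 addr0.
Qed.

(** Each coordinate of the solution is a power series in time, so solutions exist
   for all real times and their derivatives at [0] are two-sided. *)
Lemma flow_exists A f : linop A ->
  exists2 x : R -> I -> R, x 0 = f & flow A x.
Proof.
move=> lA; have [C C0 hC] := linop_bound lA; have [b b0 fb] := fun_bounded f.
pose c (g : I -> R) i k : R := iter k A g i / k`!%:R.
have c_diffs g i : pseries_diffs (c g i) = c (A g) i.
  apply/funext => k; rewrite /pseries_diffs /c factS natrM -iterSr.
  by field; rewrite addrC natr1 !pnatr_eq0 -lt0n fact_gt0.
have c_cvg g i x : cvgn (pseries (c g i) x).
  have [b' b'0 gb'] := fun_bounded g.
  apply: normed_cvg; rewrite /normed_series_of /=.
  apply: (@series_le_cvg _ _ (b' *: exp_coeff (C * `|x|))).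
  - by move=> k; apply: normr_ge0.
  - move=> k; rewrite fctE /exp_coeff /= /GRing.scale /= mulr_ge0 //.
    by rewrite divr_ge0 // exprn_ge0 // mulr_ge0.
  - move=> k; rewrite fctE /exp_coeff /= /GRing.scale /= normrM normrX.
    rewrite normrM normfV normr_nat exprMn.
    rewrite [leRHS](_ : _ = C ^+ k * b' / k`!%:R * `|x| ^+ k); last first.
      by field; rewrite pnatr_eq0 -lt0n fact_gt0.
    rewrite ler_wpM2r ?exprn_ge0 // ler_wpM2r ?invr_ge0 //.
    exact: iter_linop_bound.
  - by apply: is_cvg_seriesZ; exact: is_cvg_series_exp_coeff.
exists (fun t i => limn (pseries (c f i) t)).
  apply/funext => i; rewrite /pseries.
  apply/lim_near_cst => //.
  near=> m; rewrite -[m]prednK; last by near: m; exists 1%N.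
  rewrite /series /= big_nat_recl //= expr0 mulr1 /c /= divr1.
  by rewrite big1 ?addr0 // => k _; rewrite expr0n mulr0.
move=> t i.
have D : is_derive t (1:R) (fun x => limn (pseries (c f i) x))
          (limn (pseries (pseries_diffs (c f i)) t)).
  apply: (@pseries_snd_diffs _ _ (`|t| + 1)); rewrite ?c_diffs //.
  by rewrite (@ger0_norm _ (`|t| + 1)) ?addr_ge0 // ltrDl.
apply: is_derive_eq.
rewrite c_diffs (linop_matrix _ _ lA).
have -> : pseries (c (A f) i) t =
    fun m => \sum_j pseries (c f j) t m * A (fun k => (k == j)%:R) i.
  apply/funext => m; rewrite /pseries /series /=.
  under [RHS]eq_bigr do rewrite mulr_suml.
  rewrite exchange_big /=; apply: eq_bigr => k _.
  rewrite /c -iterSr iterS (linop_matrix _ _ lA) !mulr_suml.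
  by apply: eq_bigr => j _; ring.
apply: cvg_lim => //.
apply: cvg_big => [|j _]; first exact: add_continuous.
by apply: cvgMr_tmp; exact: c_cvg.
Unshelve. all: by end_near.
Qed.

End Flow.

(** * The Laplacian of the torus *)

Section TorusLaplacian.
Context {R : realType} {d n : nat}.
Hypotheses (d_gt0 : (0 < d)%N) (n_gt2 : (2 < n)%N).
Implicit Types (f g : torus d n -> R) (i j : torus d n) (k l : 'I_d).

Definition unit_vec k : torus d n := [ffun l => (l == k)%:R].

Lemma Zn_one_neq0 : (1 : 'Z_n) != 0.
Proof. exact: oner_neq0. Qed.

Lemma Zn_two_neq0 : (1 + 1 : 'Z_n) != 0.
Proof.
apply/eqP => /(congr1 val) /=; rewrite Zp_cast; last exact: ltnW.
by rewrite !modn_small //; apply: ltnW.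
Qed.

Lemma unit_vec_neq0 k : unit_vec k != 0.
Proof.
apply/eqP => /ffunP/(_ k); rewrite !ffunE eqxx => /eqP.
by rewrite (negbTE Zn_one_neq0).
Qed.

Lemma unit_vec_inj : injective unit_vec.
Proof.
move=> k l /ffunP/(_ k); rewrite !ffunE eqxx; by case: (k =P l).
Qed.

Lemma unit_vec_neqN k l : unit_vec k != - unit_vec l.
Proof.
apply/eqP => /ffunP/(_ k); rewrite !ffunE eqxx => /eqP; rewrite -addr_eq0.
case: (k =P l) => _; last by rewrite addr0 (negbTE Zn_one_neq0).
by rewrite (negbTE Zn_two_neq0).
Qed.

Let step i (x : 'I_d * bool) : torus d n :=
  if x.2 then i + unit_vec x.1 else i - unit_vec x.1.

(** This is where [n > 2] matters: the two neighbors in one direction differ. *)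
Lemma step_inj i : injective (step i).
Proof.
move=> [k a] [l b]; rewrite /step /=; case: a; case: b => /addrI.
- by move=> /unit_vec_inj ->.
- by move=> /eqP; rewrite (negbTE (unit_vec_neqN _ _)).
- by move=> /eqP; rewrite eq_sym (negbTE (unit_vec_neqN _ _)).
- by move=> /oppr_inj/unit_vec_inj ->.
Qed.

Lemma neighborsE i j : neighbors i j = (j \in step i @: xpredT).
Proof.
apply/existsP/imsetP => [[k /andP[jk /forallP jl]]|[[k b] _ ->]].
  have jl' l : l != k -> j l = i l by move=> lk; move: (jl l); rewrite lk => /eqP.
  exists (k, j k == i k + 1); rewrite ?inE // /step /=.
  apply/ffunP => l; case: (eqVneq l k) => [->|lk].
    case: eqVneq jk => [-> _|_ /= /eqP ->]; by rewrite !ffunE eqxx.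
  by case: ifP => _; rewrite !ffunE (negbTE lk) ?subr0 ?addr0 jl'.
exists k; rewrite /step /=; apply/andP; split.
  by case: b; rewrite !ffunE eqxx eqxx ?orbT.
apply/forallP => l; apply/implyP => lk.
by case: b; rewrite !ffunE (negbTE lk) ?subr0 ?addr0.
Qed.

Lemma nbr_avgE f i : nbr_avg f i =
  (2 * d%:R)^-1 * \sum_k (f (i + unit_vec k) + f (i - unit_vec k)).
Proof.
rewrite /nbr_avg; congr (_ * _).
under eq_bigl do rewrite neighborsE.
rewrite big_imset /=; last by move=> x y _ _; exact: step_inj.
rewrite -(pair_bigA _ (fun k b => f (step i (k, b)))) /=.
by apply: eq_bigr => k _; rewrite big_bool.
Qed.

Lemma neighbors_irrefl i j : neighbors i j -> j != i.
Proof.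
rewrite neighborsE => /imsetP[[k b] _ ->]; rewrite /step /=.
by case: b; rewrite -subr_eq0 addrAC subrr add0r ?oppr_eq0 unit_vec_neq0.
Qed.

Lemma eq_nbr_avg f g i : (forall j, j != i -> f j = g j) ->
  nbr_avg f i = nbr_avg g i.
Proof.
move=> fg; rewrite /nbr_avg; congr (_ * _); apply: eq_bigr => j ij.
exact/fg/neighbors_irrefl.
Qed.

Lemma twod_gt0 : 0 < 2 * d%:R :> R.
Proof. by rewrite mulr_gt0 // ltr0n. Qed.

Lemma nbr_avg_bound f (b : R) :
  (forall i, `|f i| <= b) -> forall i, `|nbr_avg f i| <= b.
Proof.
move=> fb i; rewrite nbr_avgE normrM gtr0_norm ?invr_gt0 ?twod_gt0 //.
rewrite ler_pdivrMl ?twod_gt0 // (le_trans (ler_norm_sum _ _ _)) //.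
have h k : `|f (i + unit_vec k) + f (i - unit_vec k)| <= b + b.
  by rewrite (le_trans (ler_normD _ _)) // lerD.
apply: le_trans (ler_sum _ (fun k _ => h k)) _.
by rewrite sumr_const card_ord -mulr_natr; lra.
Qed.

Lemma laplacian_bound f (b : R) :
  (forall i, `|f i| <= b) -> forall i, `|laplacian f i| <= 2 * b.
Proof.
move=> fb i; rewrite (le_trans (ler_normB _ _)) //.
by have := nbr_avg_bound fb i; have := fb i; lra.
Qed.

Lemma linop_nbr_avg : linop (@nbr_avg R d n).
Proof.
move=> c f g i; rewrite /nbr_avg big_split /= -mulr_sumr; ring.
Qed.

Lemma linop_laplacian : linop (@laplacian R d n).
Proof. by move=> c f g i; rewrite /laplacian linop_nbr_avg; ring. Qed.

(** Translations by opposite unit vectors are adjoint to each other, and both occur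
   in the average. *)
Lemma laplacian_self_adjoint f g :
  \sum_i laplacian f i * g i = \sum_i f i * laplacian g i.
Proof.
rewrite /laplacian.
under eq_bigr do rewrite mulrBl.
under [RHS]eq_bigr do rewrite mulrBr.
rewrite !sumrB; congr (_ - _).
under eq_bigr do rewrite nbr_avgE mulrAC -mulrA.
under [RHS]eq_bigr do rewrite nbr_avgE mulrCA.
rewrite -!mulr_sumr; congr (_ * _).
under eq_bigr do rewrite mulr_sumr.
under [RHS]eq_bigr do rewrite mulr_sumr.
rewrite exchange_big [RHS]exchange_big /=; apply: eq_bigr => k _.
under eq_bigr do rewrite mulrDr.
under [RHS]eq_bigr do rewrite mulrDr.
rewrite !big_split /= addrC; congr (_ + _).
  rewrite (reindex_inj (addIr (unit_vec k))) /=.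
  by apply: eq_bigr => i _; rewrite addrK mulrC.
rewrite (reindex_inj (addIr (- unit_vec k))) /=.
by apply: eq_bigr => i _; rewrite subrK mulrC.
Qed.

(** Along each edge, [2 f(i) f(j) <= f(i)^2 + f(j)^2]. *)
Lemma dirichlet_le0 f : \sum_i f i * laplacian f i <= 0.
Proof.
rewrite /laplacian; under eq_bigr do rewrite mulrBr.
rewrite sumrB subr_le0.
under eq_bigr do rewrite nbr_avgE mulrCA.
rewrite -mulr_sumr ler_pdivrMl ?twod_gt0 //.
under eq_bigr do rewrite mulr_sumr.
rewrite exchange_big /=.
apply: (@le_trans _ _ (\sum_(k < d) 2 * \sum_i f i * f i)); last first.
  by rewrite sumr_const card_ord -[leLHS]mulr_natr mulrAC.
apply: ler_sum => k _.
apply: (@le_trans _ _ (\sum_i (f i * f i + f (i + unit_vec k) ^+ 2 / 2 +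
   f (i - unit_vec k) ^+ 2 / 2))).
  apply: ler_sum => i _.
  have := sqr_ge0 (f i - f (i + unit_vec k)).
  have := sqr_ge0 (f i - f (i - unit_vec k)).
  rewrite !sqrrB !expr2; lra.
rewrite !big_split /= -!mulr_suml.
rewrite -(reindex_inj (addIr (unit_vec k)) (P := xpredT) (F := fun i => f i ^+ 2)) /=.
rewrite -(reindex_inj (addIr (- unit_vec k)) (P := xpredT) (F := fun i => f i ^+ 2)) /=.
under [X in X / 2]eq_bigr do rewrite expr2.
lra.
Qed.

Lemma laplacian_reflect f a i :
  laplacian (fun j => f (a - j)) i = laplacian f (a - i).
Proof.
rewrite /laplacian !nbr_avgE; congr (_ * _ - _); apply: eq_bigr => k _.
by rewrite addrC !opprD opprK !addrA.
Qed.

Lemma laplacian_delta : laplacian (fun i => (i == 0)%:R) (0 : torus d n) = -1 :> R.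
Proof.
rewrite /laplacian nbr_avgE eqxx big1 ?mulr0 ?sub0r // => k _.
by rewrite add0r sub0r oppr_eq0 (negbTE (unit_vec_neq0 k)) addr0.
Qed.

End TorusLaplacian.

(** * Second moments and the renewal equation *)

Section SecondMoment.
Context {R : realType} {d n : nat}.
Hypotheses (d_gt0 : (0 < d)%N) (n_gt2 : (2 < n)%N).
Local Notation torus := (torus d n).
Implicit Types (M : torus * torus -> R) (f : torus -> R) (i j k : torus).

Definition lap1 M (x : torus * torus) : R := laplacian (fun i => M (i, x.2)) x.1.
Definition lap2 M (x : torus * torus) : R := laplacian (fun j => M (x.1, j)) x.2.

(** Generator of the second moments [E (Y_i Y_j)]: a ring at [i] shifts [Y_i] by the
   discrepancy at [i], whose square appears on the diagonal only. *)
Definition moment_gen M (x : torus * torus) : R :=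
  lap1 M x + lap2 M x + (x.1 == x.2)%:R * lap1 (lap2 M) x.

Lemma linop_lap1 : linop lap1.
Proof. by move=> c f g x; apply: linop_laplacian. Qed.

Lemma linop_lap2 : linop lap2.
Proof. by move=> c f g x; apply: linop_laplacian. Qed.

Lemma linop_lap12 : linop (fun M => lap1 (lap2 M)).
Proof.
move=> c f g x; rewrite -linop_lap1; congr (lap1 _ x).
by apply/funext => y; rewrite linop_lap2.
Qed.

Lemma linop_moment_gen : linop moment_gen.
Proof.
by move=> c f g x; rewrite /moment_gen linop_lap12 linop_lap1 linop_lap2; ring.
Qed.

Variables (p : R -> torus -> R) (M : R -> torus * torus -> R).
Hypotheses (p0 : p 0 = fun i => (i == 0)%:R) (p_flow : flow laplacian p).
Hypotheses (M0 : M 0 = fun x => (x.1 == 0)%:R * (x.2 == 0)%:R)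
  (M_flow : flow moment_gen M).

Definition energy (t : R) : R := \sum_(i : torus) lap1 (lap2 (M t)) (i, i).

Let r u := laplacian (p u).

Lemma laplacian_flow : flow laplacian r.
Proof.
move=> t i; apply: (is_derive_linop _ _ _ p_flow); exact: linop_laplacian.
Qed.

(** If [M s] is the second moment matrix of [Y s], this is the expected squared norm
   of [L exp((t - s) L) (Y s)], which goes from the heat energy at [s = 0] to the
   energy of the process at [s = t]. *)
Let duhamel t s : R :=
  \sum_(k : torus) \sum_(i : torus) \sum_(j : torus)
    M s (i, j) * (r (t - s) (k - i) * r (t - s) (k - j)).

Lemma sum_reflect (F : torus -> R) i : \sum_(k : torus) F (k - i) = \sum_(k : torus) F k.
Proof. by rewrite (reindex_inj (addIr i)) /=; apply: eq_bigr => k _; rewrite addrK. Qed.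

Lemma laplacian_reflect_sum f g (a : torus) :
  \sum_(i : torus) laplacian f i * g (a - i) = \sum_(i : torus) f i * laplacian g (a - i).
Proof.
rewrite (laplacian_self_adjoint n_gt2 f (fun i => g (a - i))).
by apply: eq_bigr => i _; rewrite laplacian_reflect.
Qed.

(** By self-adjointness the Laplacians acting on [M] cancel against the time
   derivative of the kernel. Only the diagonal source of [moment_gen] remains, and
   translation invariance turns its contribution into a product. *)
Lemma is_derive_duhamel t (s : R) :
  is_derive s 1 (duhamel t) (energy s * heat_energy p (t - s)).
Proof.
pose dr (i : torus) := laplacian (r (t - s)) i.
have D : is_derive s 1 (duhamel t) (\sum_(k : torus) \sum_(i : torus) \sum_j
   (moment_gen (M s) (i, j) * (r (t - s) (k - i) * r (t - s) (k - j)) +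
    M s (i, j) * (- dr (k - i) * r (t - s) (k - j) +
                  r (t - s) (k - i) * - dr (k - j)))).
  apply: is_derive_bigsum => k; apply: is_derive_bigsum => i.
  apply: is_derive_bigsum => j; apply: is_derive_mul; first exact: M_flow.
  by apply: is_derive_mul;
    apply: (@is_derive_reflect _ (fun u => r u _)); exact: laplacian_flow.
apply: is_derive_eq.
transitivity (\sum_(k : torus) \sum_(i : torus)
    lap1 (lap2 (M s)) (i, i) * r (t - s) (k - i) ^+ 2);
  last first.
  rewrite exchange_big /= /energy mulr_suml; apply: eq_bigr => i _.
  by rewrite -mulr_sumr (sum_reflect (fun k => r (t - s) k ^+ 2)).
apply: eq_bigr => k _.
pose a i := r (t - s) (k - i); pose b i := dr (k - i).
have E1 : \sum_(i : torus) \sum_(j : torus) lap1 (M s) (i, j) * (a i * a j) =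
          \sum_(i : torus) \sum_(j : torus) M s (i, j) * (b i * a j).
  rewrite exchange_big [RHS]exchange_big /=; apply: eq_bigr => j _.
  under eq_bigr do rewrite mulrA.
  under [RHS]eq_bigr do rewrite mulrA.
  rewrite -!mulr_suml; congr (_ * _).
  exact: (laplacian_reflect_sum (fun i => M s (i, j)) (r (t - s))).
have E2 : \sum_(i : torus) \sum_(j : torus) lap2 (M s) (i, j) * (a i * a j) =
          \sum_(i : torus) \sum_(j : torus) M s (i, j) * (a i * b j).
  apply: eq_bigr => i _.
  under eq_bigr do rewrite mulrCA.
  under [RHS]eq_bigr do rewrite mulrCA.
  rewrite -!mulr_sumr; congr (_ * _).
  exact: (laplacian_reflect_sum (fun j => M s (i, j)) (r (t - s))).
transitivity (\sum_(i : torus) \sum_(j : torus)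
    (i == j)%:R * lap1 (lap2 (M s)) (i, j) * (a i * a j)
  + ((\sum_(i : torus) \sum_(j : torus) lap1 (M s) (i, j) * (a i * a j) -
      \sum_(i : torus) \sum_(j : torus) M s (i, j) * (b i * a j)) +
     (\sum_(i : torus) \sum_(j : torus) lap2 (M s) (i, j) * (a i * a j) -
      \sum_(i : torus) \sum_(j : torus) M s (i, j) * (a i * b j)))).
  rewrite -!sumrB -!big_split /=; apply: eq_bigr => i _.
  rewrite -!sumrB -!big_split /=; apply: eq_bigr => j _.
  rewrite /moment_gen /= /a /b; ring.
rewrite E1 E2 !subrr !addr0; apply: eq_bigr => i _.
rewrite (bigD1 i) //= eqxx mul1r big1 ?addr0 // => j.
by rewrite eq_sym => /negbTE ->; rewrite !mul0r.
Qed.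

Lemma delta_convolve f k :
  \sum_(i : torus) f i * r 0 (k - i) = laplacian f k.
Proof.
rewrite /r p0 -laplacian_reflect_sum (bigD1 k) //= subrr eqxx mulr1.
rewrite big1 ?addr0 // => i ik.
by rewrite subr_eq0 eq_sym (negbTE ik) mulr0.
Qed.

Lemma duhamel_start t : duhamel t 0 = heat_energy p t.
Proof.
apply: eq_bigr => k _; rewrite M0 subr0.
rewrite (bigD1 (0 : torus)) //= [X in _ + X]big1 => [|i i0]; last first.
  by rewrite big1 // => j _; rewrite (negbTE i0) !mul0r.
rewrite addr0 (bigD1 (0 : torus)) //= [X in _ + X]big1 => [|j j0]; last first.
  by rewrite (negbTE j0) mulr0 mul0r.
by rewrite !eqxx !addr0 !mul1r subr0.
Qed.

Lemma duhamel_end t : duhamel t t = energy t.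
Proof.
apply: eq_bigr => k _; rewrite subrr.
under eq_bigr => i _.
  under eq_bigr do rewrite mulrCA.
  rewrite -mulr_sumr (delta_convolve (fun j => M t (i, j))) mulrC; over.
exact: (delta_convolve (fun i => lap2 (M t) (i, k))).
Qed.

(** The renewal equation for the energy, with the convolution integral stated
   through one of its primitives. *)
Lemma energy_renewal t : exists K : R -> R,
  [/\ K 0 = heat_energy p t, K t = energy t &
   forall s : R, is_derive s 1 K (energy s * heat_energy p (t - s))].
Proof.
exists (duhamel t); split; [exact: duhamel_start|exact: duhamel_end|].
exact: is_derive_duhamel.
Qed.

Lemma energy_continuous t : {for t, continuous energy}.
Proof.
apply: (@is_derive_continuous _ _ _
  (\sum_(i : torus) lap1 (lap2 (moment_gen (M t))) (i, i))).
apply: is_derive_bigsum => i.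
exact: (is_derive_linop _ _ linop_lap12 M_flow).
Qed.

(** A primitive is half the Dirichlet form [sum p (L p)], which is nonpositive and
   starts from [-1/2]. Hence [G] has mass at most [1/2], which is what makes the
   renewal equation subcritical. *)
Lemma heat_energy_primitive : exists Q : R -> R,
  [/\ Q 0 = - 2^-1, forall u, Q u <= 0 &
   forall u : R, is_derive u 1 Q (heat_energy p u)].
Proof.
exists (fun u => 2^-1 * \sum_(i : torus) p u i * r u i); split.
- rewrite /r p0 (bigD1 (0 : torus)) //= eqxx mul1r laplacian_delta // big1 => [|i i0].
    by rewrite addr0 mulrN1.
  by rewrite (negbTE i0) mul0r.
- by move=> u; rewrite pmulr_rle0 // dirichlet_le0.
- move=> u.
  have D : is_derive u 1 (fun u => \sum_(i : torus) p u i * r u i)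
     (\sum_(i : torus) (laplacian (p u) i * r u i + p u i * laplacian (r u) i)).
    apply: is_derive_bigsum => i; apply: is_derive_mul; first exact: p_flow.
    exact: laplacian_flow.
  apply: (is_derive_eq (is_derive_scale 2^-1 D)).
  rewrite big_split /= -(laplacian_self_adjoint n_gt2 (p u)) /heat_energy.
  by under [RHS]eq_bigr do rewrite expr2; rewrite /r; lra.
Qed.

Lemma heat_energy_ge0 t : 0 <= heat_energy p t.
Proof. by apply: sumr_ge0 => i _; exact: sqr_ge0. Qed.

(** The heat energy decreases because [L] is nonpositive, and at time [0] it is
   [(L (L delta))(0)]. *)
Lemma heat_energy_le4 (t : R) : 0 <= t -> heat_energy p t <= 4.
Proof.
move=> t0; apply: (@le_trans _ _ (heat_energy p 0)).
  rewrite -subr_le0.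
  pose dG u := \sum_(i : torus) (laplacian (r u) i * r u i + r u i * laplacian (r u) i).
  have D (u : R) : is_derive u 1 (heat_energy p) (dG u).
    apply: is_derive_bigsum => i.
    rewrite (_ : (fun _ => _) = fun u => r u i * r u i); last first.
      by apply/funext => v; rewrite expr2.
    by apply: is_derive_mul; exact: laplacian_flow.
  have dG_le0 u : dG u <= 0.
    rewrite /dG big_split /= laplacian_self_adjoint //.
    by have := dirichlet_le0 d_gt0 n_gt2 (r u); lra.
  have := increment_le t0 (fun u _ => D u) (fun u _ => is_derive_cst (0 : R) u 1)
    (fun u _ => dG_le0 u).
  by rewrite subrr.
rewrite /heat_energy p0; under eq_bigr do rewrite expr2.
rewrite laplacian_self_adjoint // (bigD1 (0 : torus)) //= eqxx mul1r.
rewrite big1 ?addr0; last first.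
  by move=> i i0; rewrite (negbTE i0) mul0r.
rewrite (le_trans (ler_norm _)) // (_ : 4 = 2 * (2 * 1)); last by ring.
do 2![apply: laplacian_bound => // ?].
by case: eqP; rewrite ?normr1 ?normr0.
Qed.

Lemma flow_heat_kernel : is_heat_kernel p.
Proof.
move=> i; split; first by rewrite p0.
  apply: cvg_at_right_filter; exact: (is_derive_continuous (p_flow 0 i)).
by move=> t _; exact: p_flow.
Qed.

End SecondMoment.

(** * The decay scale *)

Section DecayScale.
Context {R : realType} (d n : nat).
Hypothesis n_gt0 : (0 < n)%N.
Local Notation alpha := (d%:R / 2 + 2 : R).
Local Notation c := ((n%:R ^+ (d + 4))^-1 : R).
Local Notation scale := (@decay_scale R d n).

Lemma alpha_ge2 : 2 <= alpha.
Proof. by rewrite lerDr divr_ge0. Qed.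

Lemma nX_gt0 : 0 < n%:R ^+ (d + 4) :> R.
Proof. by rewrite exprn_gt0 // ltr0n. Qed.

Lemma scale_gt0 (t : R) : 0 < t -> 0 < scale t.
Proof. by move=> t0; rewrite /decay_scale lt_min powR_gt0 // nX_gt0. Qed.

Lemma scale_inv_le (t : R) : 0 < t -> (scale t)^-1 <= (t `^ alpha)^-1 + c.
Proof.
move=> t0; rewrite /decay_scale minEle; case: ifP => _.
  by rewrite lerDl invr_ge0 ltW // nX_gt0.
by rewrite lerDr invr_ge0 powR_ge0.
Qed.

Lemma powR_inv_le_scale (t : R) : 0 < t -> (t `^ alpha)^-1 <= (scale t)^-1.
Proof.
move=> t0; rewrite lef_pV2 ?posrE ?scale_gt0 ?powR_gt0 //.
by rewrite /decay_scale ge_min lexx.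
Qed.

Lemma nX_inv_le_scale (t : R) : 0 < t -> c <= (scale t)^-1.
Proof.
move=> t0; rewrite lef_pV2 ?posrE ?scale_gt0 ?nX_gt0 //.
by rewrite /decay_scale ge_min lexx orbT.
Qed.

Lemma powR_inv_le_sqr (t : R) : 1 <= t -> (t `^ alpha)^-1 <= t ^- 2.
Proof.
move=> t1; have t0 : 0 < t by apply: lt_le_trans t1.
rewrite lef_pV2 ?posrE ?powR_gt0 ?exprn_gt0 //.
by rewrite -powR_mulrn ?(ltW t0) // ler_powR // alpha_ge2.
Qed.

Lemma decay_scale_continuous (t : R) : 0 < t -> {for t, continuous scale}.
Proof.
move=> t0; apply: continuous_min; last exact: cvg_cst.
exact: (is_derive_continuous (is_derive1_powR _ t0)).
Qed.

(** Shrinking the time by a factor [1 - x] with [(d + 2) x <= 1/9] costs at most a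
   factor [9/8], by Bernoulli's inequality, since [alpha <= d + 2]. *)
Lemma scale_shrink (s t : R) : 0 < t -> t * (1 - (9 * (d%:R + 2))^-1) <= s ->
  (scale s)^-1 <= 9 / 8 * (scale t)^-1.
Proof.
move=> t0; set x := (9 * (d%:R + 2))^-1 => ts.
have d2 : 0 < d%:R + 2 :> R by rewrite ltr_wpDl.
have x0 : 0 < x by rewrite invr_gt0 mulr_gt0.
have x1 : x <= 18^-1.
  rewrite lef_pV2 ?posrE ?mulr_gt0 //.
  by have := ler0n R d; lra.
have y0 : 0 < 1 - x by lra.
have s0 : 0 < s by apply: lt_le_trans ts; rewrite mulr_gt0.
have bernoulli : forall k : nat, 1 - k%:R * x <= (1 - x) ^+ k.
  elim=> [|k IH]; first by rewrite mul0r subr0.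
  rewrite exprS -natr1.
  apply: (@le_trans _ _ ((1 - x) * (1 - k%:R * x))); last by rewrite ler_wpM2l // ltW.
  have : 0 <= k%:R * x * x by rewrite !mulr_ge0 // ltW.
  lra.
have h : 8 / 9 <= (1 - x) `^ alpha.
  apply: (@le_trans _ _ ((1 - x) ^+ (d + 2))).
    apply: le_trans (bernoulli _).
    rewrite natrD (_ : _ * x = 9^-1); first by lra.
    by rewrite /x; field; rewrite gt_eqF.
  rewrite -powR_mulrn ?(ltW y0) // ger_powR ?natrD ?lerD2r //.
    by rewrite y0 lerBlDr lerDl ltW.
  by rewrite ler_pdivrMr // ler_peMr // ler1n.
suff : 8 / 9 * scale t <= scale s.
  move=> h1; rewrite (_ : 9 / 8 = (8 / 9)^-1); last by field.
  by rewrite -invfM lef_pV2 ?posrE ?mulr_gt0 ?scale_gt0.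
rewrite /decay_scale le_min; apply/andP; split.
  apply: (@le_trans _ _ (8 / 9 * t `^ alpha)).
    by rewrite ler_wpM2l // ge_min lexx.
  apply: (@le_trans _ _ ((1 - x) `^ alpha * t `^ alpha)).
    by rewrite ler_wpM2r // powR_ge0.
  rewrite -powRM ?(ltW y0) ?(ltW t0) // ge0_ler_powR ?nnegrE ?mulr_ge0
    ?(ltW y0) ?(ltW t0) ?(ltW s0) //.
  by rewrite mulrC.
have m : Num.min (t `^ alpha) (n%:R ^+ (d + 4)) <= n%:R ^+ (d + 4).
  by rewrite ge_min lexx orbT.
have := nX_gt0; move: m; set X := Num.min _ _; set Y := n%:R ^+ _; lra.
Qed.

(** Of two times with sum [t], one is at least [t / 2]. *)
Lemma powR_inv_mul_le (s u t : R) : 1 <= s -> 1 <= u -> s + u = t ->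
  (s `^ alpha)^-1 * (u `^ alpha)^-1 <=
  2 `^ alpha * (t `^ alpha)^-1 * (s ^- 2 + u ^- 2).
Proof.
wlog su : s u / u <= s => [hw s1 u1 st|s1 u1 st].
  case/orP: (le_total u s) => su; first exact: (hw s u).
  by rewrite mulrC [s ^- 2 + _]addrC; apply: hw => //; rewrite addrC.
have s0 : 0 < s by lra.
have u0 : 0 < u by lra.
have t0 : 0 < t by lra.
apply: ler_pM; rewrite ?invr_ge0 ?powR_ge0 //.
  rewrite -[2 `^ _]invrK -invfM lef_pV2 ?posrE ?mulr_gt0 ?invr_gt0 ?powR_gt0 //.
  rewrite mulrC ler_pdivrMr ?powR_gt0 // -powRM ?(ltW s0) //.
  rewrite ge0_ler_powR ?nnegrE ?mulr_ge0 ?(ltW s0) ?(ltW t0) //; lra.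
apply: (le_trans (powR_inv_le_sqr u1)).
by rewrite lerDr invr_ge0 exprn_ge0 // ltW.
Qed.

End DecayScale.

(** * Upper bound for the renewal equation *)

(** Both functions are tilted by [exp (a t)], where the rate [a] falls short of the
   decay rate [b] of [G] by [eps]. The loss [eps] is what makes the constant floor
   [c] of the inverse scale integrable: against [exp (- eps u)] it contributes
   [beta2 c / eps = 1/4] to the mass of the tilted kernel, in addition to the mass
   [1/2] of [G]. After time [T0], going back by [A] changes the scale by a factor
   at most [9/8]. *)
Section RenewalBound.
Context {R : realType} (d n : nat) (beta2 b A : R) (H G : R -> R).
Local Notation alpha := (d%:R / 2 + 2 : R).
Local Notation c := ((n%:R ^+ (d + 4))^-1 : R).
Local Notation scale := (@decay_scale R d n).
Local Notation eps := (4 * beta2 / n%:R ^+ (d + 4)).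
Local Notation a := (b - eps).
Local Notation T0 := (9 * (d%:R + 2) * A).
Hypotheses (n_gt0 : (0 < n)%N) (beta2_gt0 : 0 < beta2) (b_ge0 : 0 <= b).
Hypotheses (A_ge1 : 1 <= A) (A_large : 32 * beta2 * (2 `^ alpha + 1) <= A)
  (bA_small : b * A <= 9^-1).
Hypotheses (H_ge0 : forall t : R, 0 <= t -> 0 <= H t)
  (H_continuous : forall t : R, {for t, continuous H}).
Hypotheses (G_ge0 : forall t, 0 <= G t) (G_le4 : forall t : R, 0 <= t -> G t <= 4)
  (G_decay : forall t, A <= t -> G t <= beta2 / scale t * expR (- (b * t))).
Hypothesis renewal : forall t, exists K : R -> R,
  [/\ K 0 = G t, K t = H t & forall s : R, is_derive s 1 K (H s * G (t - s))].
Hypothesis G_primitive : exists Q : R -> R,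
  [/\ Q 0 = - 2^-1, forall u, Q u <= 0 & forall u : R, is_derive u 1 Q (G u)].

Let A_gt0 : 0 < A. Proof. exact: lt_le_trans A_ge1. Qed.
Let A_ge0 := ltW A_gt0.
Let eps_gt0 : 0 < eps.
Proof. by rewrite divr_gt0 ?mulr_gt0 // nX_gt0. Qed.

Let T0_ge : 18 * A <= T0.
Proof. by rewrite ler_pM2r //; have := ler0n R d; lra. Qed.

(** At the maximum of the energy over a time interval the renewal equation
   bounds it by [4] plus half of itself. *)
Lemma renewal_bounded (t : R) : 0 <= t -> H t <= 8.
Proof.
move=> t0.
have [|x xt xmax] := EVT_max (f := H) t0.
  by apply: continuous_subspaceT => x; exact: H_continuous.
have {xt} /andP[x0 xt] : 0 <= x <= t by move: xt; rewrite in_itv.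
have [K [K0 Kx dK]] := renewal x; have [Q [Q0 Qle dQ]] := G_primitive.
have dQ' s : 0 <= s <= x ->
    is_derive s 1 (fun s => H x * (-1 * Q (x - s))) (H x * (-1 * - G (x - s))).
  by move=> _; do 2 apply: is_derive_scale; exact: is_derive_reflect.
have hle s : 0 <= s <= x -> H s * G (x - s) <= H x * (-1 * - G (x - s)).
  move=> /andP[s0 sx]; rewrite mulN1r opprK ler_wpM2r // xmax // in_itv /= s0.
  exact: le_trans xt.
have := increment_le x0 (fun s _ => dK s) dQ' hle.
rewrite K0 Kx subrr Q0 subr0 => h.
have h2 : 0 <= H x * - Q x by rewrite mulr_ge0 ?H_ge0 // oppr_ge0.
have Gx := G_le4 x0.
apply: (@le_trans _ _ (H x)); first by apply: xmax; rewrite in_itv /= t0 lexx.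
lra.
Qed.

Let h s := expR (a * s) * H s.
Let g u := expR (a * u) * G u.

Lemma tilted_renewal t : exists K : R -> R,
  [/\ K 0 = g t, K t = h t & forall s : R, is_derive s 1 K (h s * g (t - s))].
Proof.
have [K [K0 Kt dK]] := renewal t.
exists (fun s => expR (a * t) * K s); split; rewrite ?K0 ?Kt // => s.
apply: (is_derive_eq (is_derive_scale (expR (a * t)) (dK s))).
rewrite /h /g [in LHS](_ : a * t = a * s + a * (t - s)); last by ring.
by rewrite expRD; ring.
Qed.

Let h_ge0 (s : R) : 0 <= s -> 0 <= h s.
Proof. by move=> s0; rewrite mulr_ge0 ?expR_ge0 // H_ge0. Qed.

Let g_ge0 u : 0 <= g u.
Proof. by rewrite mulr_ge0 ?expR_ge0. Qed.

Let as_le (s B : R) : 0 <= s <= B -> a * s <= b * B.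
Proof.
move=> /andP[s0 sB]; apply: (@le_trans _ _ (b * s)).
  by rewrite ler_wpM2r // lerBlDr lerDl ltW.
by rewrite ler_wpM2l.
Qed.

Lemma tilt_le (s : R) : 0 <= s <= A -> expR (a * s) <= 9 / 8.
Proof.
move=> /as_le sA; apply: (@le_trans _ _ (expR 9^-1)).
  by rewrite ler_expR (le_trans sA).
rewrite -[leLHS]invrK -expRN (_ : 9 / 8 = (8 / 9)^-1); last by field.
rewrite lef_pV2 ?posrE ?expR_gt0 //.
by apply: le_trans (expR_ge1Dx _); lra.
Qed.

Lemma g_decay u : A <= u -> g u <= beta2 * ((scale u)^-1 * expR (- (eps * u))).
Proof.
move=> Au; rewrite /g.
apply: (@le_trans _ _ (expR (a * u) * (beta2 / scale u * expR (- (b * u))))).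
  by rewrite ler_wpM2l ?expR_ge0 // G_decay.
rewrite [leRHS](_ : _ = beta2 / scale u * (expR (a * u) * expR (- (b * u)))).
  by rewrite mulrCA.
by rewrite -expRD mulrA; congr (_ * expR _); ring.
Qed.

Lemma g_le_scale u : A <= u -> g u <= beta2 * (scale u)^-1.
Proof.
move=> Au; have u0 : 0 < u by apply: lt_le_trans Au.
apply: le_trans (g_decay Au) _.
apply: ler_wpM2l; first exact: ltW.
rewrite ler_piMr ?invr_ge0 ?(ltW (scale_gt0 d n_gt0 u0)) //.
by rewrite expR_le1 oppr_le0 mulr_ge0 // ltW.
Qed.

(** The primitive of the convolution is split into three increments. Near time [0]
   the energy is merely bounded and the kernel is already small. *)
Lemma early_increment (t : R) (K : R -> R) : T0 <= t ->
  (forall s : R, is_derive s 1 K (h s * g (t - s))) ->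
  K A - K 0 <= 21 / 2 * beta2 * A * (scale t)^-1.
Proof.
move=> tT dK; have T18 := le_trans T0_ge tT; have A1 := A_ge1.
have t0 : 0 < t by lra.
pose C := 21 / 2 * beta2 * (scale t)^-1.
have dC s : 0 <= s <= A -> is_derive s 1 (fun s : R => C * s) (C * 1).
  by move=> _; apply: is_derive_scale; exact: is_derive_id.
have le s : 0 <= s <= A -> h s * g (t - s) <= C * 1.
  move=> sA; have /andP[s0 sA'] := sA.
  have hs : h s <= 9.
    rewrite (_ : 9 = 9 / 8 * 8); last by field.
    apply: ler_pM; rewrite ?expR_ge0 ?H_ge0 ?renewal_bounded //.
    exact: tilt_le.
  have gs : g (t - s) <= beta2 * (9 / 8 * (scale t)^-1).
    apply: (@le_trans _ _ (beta2 * (scale (t - s))^-1)).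
      by apply: g_le_scale; lra.
    apply: ler_wpM2l; first exact: ltW.
    rewrite scale_shrink // mulrBr mulr1 lerD2l lerN2.
    apply: (le_trans sA'); rewrite ler_pdivlMr ?mulr_gt0 ?ltr_wpDl //.
    by rewrite mulrC.
  apply: (@le_trans _ _ (9 * (beta2 * (9 / 8 * (scale t)^-1)))).
    by apply: ler_pM => //; exact: h_ge0.
  have : 0 <= beta2 * (scale t)^-1.
    by rewrite mulr_ge0 ?ltW // invr_gt0 scale_gt0.
  by rewrite /C; lra.
have := increment_le A_ge0 (fun s _ => dK s) dC le.
by rewrite mulr0 subr0 /C; lra.
Qed.

(** Each of the scale and the tilt costs a factor [9/8] on top of the mass [1/2]
   of [G]. *)
Lemma late_increment (t : R) (K : R -> R) (k : R) : T0 <= t -> 0 <= k ->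
  (forall s, t - A <= s <= t -> h s <= k * (scale s)^-1) ->
  (forall s : R, is_derive s 1 K (h s * g (t - s))) ->
  K t - K (t - A) <= 81 / 128 * (k * (scale t)^-1).
Proof.
move=> tT k0 hk dK; have T18 := le_trans T0_ge tT; have A1 := A_ge1.
have t0 : 0 < t by lra.
have [Q [Q0 Qle dQ]] := G_primitive.
have kt : 0 <= k * (scale t)^-1 by rewrite mulr_ge0 // invr_ge0 ltW // scale_gt0.
pose C := 81 / 64 * (k * (scale t)^-1).
have C0 : 0 <= C by rewrite mulr_ge0.
have dC s : t - A <= s <= t ->
    is_derive s 1 (fun s => C * (-1 * Q (t - s))) (C * (-1 * - G (t - s))).
  by move=> _; do 2 apply: is_derive_scale; exact: is_derive_reflect.
have le s : t - A <= s <= t -> h s * g (t - s) <= C * (-1 * - G (t - s)).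
  move=> sA; have /andP[As st] := sA.
  have hs : h s <= 9 / 8 * (k * (scale t)^-1).
    apply: le_trans (hk _ sA) _; rewrite mulrCA ler_wpM2l // scale_shrink //.
    apply: le_trans As; rewrite mulrBr mulr1 lerD2l lerN2.
    by rewrite ler_pdivlMr ?mulr_gt0 ?ltr_wpDl // mulrC.
  have gs : g (t - s) <= 9 / 8 * G (t - s).
    by rewrite ler_wpM2r // tilt_le //; apply/andP; split; lra.
  rewrite mulN1r opprK /C (_ : 81 / 64 = 9 / 8 * (9 / 8)); last by field.
  rewrite [leRHS](_ : _ = 9 / 8 * (k * (scale t)^-1) * (9 / 8 * G (t - s))); last by ring.
  by apply: ler_pM => //; apply: h_ge0; lra.
have tA : t - A <= t by lra.
have := increment_le tA (fun s _ => dK s) dC le.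
rewrite subrr Q0 (_ : t - (t - A) = A); last by ring.
have : 0 <= C * - Q A by rewrite mulr_ge0 // oppr_ge0.
by rewrite /C; lra.
Qed.

(** The parts of the two inverse scales that decay like [s ^- 2] integrate to at most
   [2 / A], which the choice of [A] makes small; the floor of the inverse scale
   gives the fraction [1/4]. *)
Lemma middle_increment (t : R) (K : R -> R) (k : R) : T0 <= t -> 0 <= k ->
  (forall s, A <= s <= t - A -> h s <= k * (scale s)^-1) ->
  (forall s : R, is_derive s 1 K (h s * g (t - s))) ->
  K (t - A) - K A <= 5 / 16 * (k * (scale t)^-1).
Proof.
move=> tT k0 hk dK; have T18 := le_trans T0_ge tT; have A1 := A_ge1.
have t0 : 0 < t by lra.
have f0 : 0 < (scale t)^-1 by rewrite invr_gt0 scale_gt0.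
have kf0 : 0 <= k * (scale t)^-1 by rewrite mulr_ge0 // ltW.
pose C := beta2 * (k * (scale t)^-1); pose D := 2 `^ alpha + 1 : R.
have C0 : 0 <= C by rewrite mulr_ge0 // ltW.
pose F s := C * (D * (-1 * s^-1 + (t - s)^-1) + c / eps * expR (- (eps * (t - s)))).
pose dF s := C * (D * (-1 * - s ^- 2 + (t - s) ^- 2)
  + c / eps * (eps * expR (- (eps * (t - s))))).
have dFP (s : R) : A <= s <= t - A -> is_derive s 1 F (dF s).
  move=> /andP[As sA].
  have dV (u : R) : 0 < u -> is_derive u 1 (fun u : R => u^-1) (- u ^- 2).
    move=> u0; have := @is_deriveV _ (fun u : R => u) u 1 1 _ (is_derive_id u 1).
    by rewrite /GRing.scale /= mulr1; apply; rewrite gt_eqF.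
  apply: is_derive_scale; apply: is_derive_add; apply: is_derive_scale.
    apply: is_derive_add.
      by apply: is_derive_scale; apply: dV; lra.
    rewrite -[X in is_derive _ _ _ X]opprK.
    by apply: (@is_derive_reflect _ (fun u => u^-1)); apply: dV; lra.
  rewrite (_ : eps * _ = - (- eps * expR (- (eps * (t - s))))); last by ring.
  apply: (@is_derive_reflect _ (fun u => expR (- (eps * u)))).
  have d1 : is_derive (t - s) 1 (fun u : R => - eps * u) (- eps).
    by have := is_derive_scale (- eps) (is_derive_id (t - s) (1 : R)); rewrite mulr1.
  rewrite (_ : (fun u => _) = expR \o (fun u => - eps * u)); last first.
    by apply/funext => u; rewrite /= mulNr.
  apply: (is_derive_eq (is_derive1_comp (is_derive_expR (- eps * (t - s))) d1)).
  by rewrite [LHS]mulrC [- eps * (t - s)]mulNr.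
have le s : A <= s <= t - A -> h s * g (t - s) <= dF s.
  move=> sA; have /andP[As sA'] := sA.
  pose u := t - s; have uE : s + u = t by rewrite /u; ring.
  have Au : A <= u by rewrite /u; lra.
  have s0 : 0 < s by lra.
  have u0 : 0 < u by lra.
  have s1 : 1 <= s by lra.
  have u1 : 1 <= u by lra.
  have e1 : expR (- (eps * u)) <= 1.
    by rewrite expR_le1 oppr_le0 mulr_ge0 // ltW.
  have e0 : 0 <= expR (- (eps * u)) by exact: expR_ge0.
  have c0 : 0 <= c by rewrite invr_ge0 ltW // nX_gt0.
  apply: (@le_trans _ _ (k * (scale s)^-1 *
      (beta2 * ((scale u)^-1 * expR (- (eps * u)))))).
    by apply: ler_pM => //; [apply: h_ge0; exact: ltW|exact: hk|exact: g_decay].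
  rewrite [leLHS](_ : _ = beta2 * k *
    ((scale s)^-1 * ((scale u)^-1 * expR (- (eps * u))))); last by ring.
  rewrite /dF /C -/u [leRHS](_ : _ = beta2 * k * ((scale t)^-1 *
    (D * (s ^- 2 + u ^- 2) + c * expR (- (eps * u))))); last first.
    by field; rewrite !gt_eqF ?scale_gt0 ?nX_gt0.
  apply: ler_wpM2l; first by rewrite mulr_ge0 // ltW.
  set e := expR _ in e1 e0 *.
  have Us := scale_inv_le d n_gt0 s0; have Uu := scale_inv_le d n_gt0 u0.
  have sc0 : 0 <= (scale s)^-1 by rewrite invr_ge0 ltW // scale_gt0.
  have uc0 : 0 <= (scale u)^-1 by rewrite invr_ge0 ltW // scale_gt0.
  have PP := powR_inv_mul_le d s1 u1 uE.
  have Ps := powR_inv_le_sqr d s1; have Pu := powR_inv_le_sqr d u1.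
  have Pt := powR_inv_le_scale d n_gt0 t0; have ct := nX_inv_le_scale d n_gt0 t0.
  move: Us Uu PP Ps Pu Pt ct.
  have xs0 : 0 <= (s `^ alpha)^-1 by rewrite invr_ge0 powR_ge0.
  have xu0 : 0 <= (u `^ alpha)^-1 by rewrite invr_ge0 powR_ge0.
  have w0 : 0 <= 2 `^ alpha :> R by exact: powR_ge0.
  have s20 : 0 <= s ^- 2 by rewrite invr_ge0 exprn_ge0 // ltW.
  have u20 : 0 <= u ^- 2 by rewrite invr_ge0 exprn_ge0 // ltW.
  move: xs0 xu0 w0 s20 u20 sc0 uc0 f0 c0; rewrite /D.
  set ss := (scale s)^-1; set su := (scale u)^-1; set st := (scale t)^-1.
  set xs := (s `^ _)^-1; set xu := (u `^ _)^-1; set xt := (t `^ _)^-1.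
  set w := 2 `^ _; set cc := (n%:R ^+ _)^-1; set p := s ^- 2; set q := u ^- 2.
  move=> xs0 xu0 w0 p0 q0 ss0 su0 st0 cc0 Us Uu PP Ps Pu Pt ct.
  apply: (@le_trans _ _ ((xs + cc) * (xu + cc * e))).
    apply: ler_pM => //; first by rewrite mulr_ge0.
    apply: (@le_trans _ _ ((xu + cc) * e)); first by rewrite ler_wpM2r.
    by rewrite mulrDl lerD2r ler_piMr.
  have h1 : xs * xu <= w * st * (p + q).
    apply: le_trans PP _; rewrite ler_wpM2r ?addr_ge0 // ler_wpM2l //.
  have h2 : xs * (cc * e) <= st * p.
    rewrite mulrC; apply: ler_pM => //; first by rewrite mulr_ge0.
    by apply: le_trans ct; rewrite ler_piMr.
  have h3 : cc * xu <= st * q by apply: ler_pM.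
  have h4 : cc * (cc * e) <= st * (cc * e) by rewrite ler_wpM2r // mulr_ge0.
  by lra.
have AtA : A <= t - A by lra.
apply: le_trans (increment_le AtA (fun s _ => dK s) dFP le) _.
rewrite /F (_ : t - (t - A) = A); last by ring.
have v0 : 0 <= (t - A)^-1 by rewrite invr_ge0; lra.
have D0 : 0 <= D by rewrite addr_ge0 // powR_ge0.
have e1 : expR (- (eps * A)) <= 1 by rewrite expR_le1 oppr_le0 mulr_ge0 // ltW.
have e0 : 0 <= expR (- (eps * (t - A))) by exact: expR_ge0.
have ce : c / eps = (4 * beta2)^-1.
  by field; rewrite !gt_eqF ?nX_gt0.
have DA : beta2 * (D * A^-1) <= 32^-1.
  rewrite mulrA ler_pdivrMr //; move: A_large; rewrite -/D; lra.
apply: (@le_trans _ _ (C * (D * (2 * A^-1) + (4 * beta2)^-1))).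
  rewrite -mulrBr ler_wpM2l // ce.
  have Dv : 0 <= D * (t - A)^-1 by rewrite mulr_ge0.
  have b4 : 0 <= (4 * beta2)^-1 by rewrite invr_ge0 mulr_ge0 // ltW.
  have x1 : (4 * beta2)^-1 * expR (- (eps * A)) <= (4 * beta2)^-1.
    by rewrite ler_piMr.
  have x2 : 0 <= (4 * beta2)^-1 * expR (- (eps * (t - A))) by rewrite mulr_ge0.
  by lra.
rewrite (_ : C * _ = k * (scale t)^-1 * (2 * (beta2 * (D * A^-1)) + 4^-1)).
  by have := ler_wpM2l kf0 DA; lra.
by rewrite /C; field; rewrite !gt_eqF ?scale_gt0.
Qed.

Let C1 := beta2 + 21 / 2 * beta2 * A.
Let C2 := 8 * expR (d%:R + 2) * T0 `^ alpha.

Lemma h_initial (t : R) : 1 <= t <= T0 -> h t * scale t <= C2.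
Proof.
move=> /andP[t1 tT].
have t0 : 0 < t by lra.
have sc0 : 0 <= scale t by apply/ltW/scale_gt0.
have ht0 := h_ge0 (ltW t0).
apply: ler_pM => //.
- rewrite mulrC; apply: ler_pM; rewrite ?expR_ge0 ?renewal_bounded ?H_ge0 ?(ltW t0) //.
  rewrite ler_expR; have tT' : 0 <= t <= T0 by rewrite (ltW t0).
  apply: le_trans (as_le tT') _.
  rewrite (_ : b * T0 = 9 * (d%:R + 2) * (b * A)); last by ring.
  rewrite mulrAC -[leRHS]mul1r ler_wpM2r ?addr_ge0 //.
  by have := bA_small; lra.
- apply: (@le_trans _ _ (t `^ alpha)); first by rewrite ge_min lexx.
  rewrite ge0_ler_powR ?nnegrE //; last by lra.
  by have := @alpha_ge2 R d; lra.
Qed.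

(** At the maximum of [h * scale] the three increments bound [h] by a constant plus
   the fraction [5/16 + 81/128 = 121/128] of itself. *)
Lemma tilted_bound (t : R) : 1 <= t -> h t * scale t <= Num.max C2 (19 * C1).
Proof.
move=> t1; have [tT|/ltW tT] := leP t T0.
  by rewrite le_max h_initial // t1.
have T18 := le_trans T0_ge tT; have A1 := A_ge1.
have At : A <= t by lra.
pose phi s := h s * scale s.
have phi_cont : {within `[A, t], continuous phi}.
  apply: continuous_in_subspaceT => s; rewrite inE /= in_itv /= => /andP[As _].
  have s0 : 0 < s by lra.
  have c1 : {for s, continuous h}.
    apply: continuousM; last exact: H_continuous.
    apply: (@continuous_comp _ _ _ (fun s => a * s) expR).
      by apply: continuousM; [exact: cvg_cst|exact: cvg_id].
    exact: continuous_expR.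
  exact: (continuousM c1 (decay_scale_continuous s0)).
have [x xin xmax] := EVT_max At phi_cont.
have {xin} /andP[Ax xt] : A <= x <= t by move: xin; rewrite in_itv.
apply: (@le_trans _ _ (phi x)); first by apply: xmax; rewrite in_itv /= At lexx.
have x0 : 0 < x by lra.
have [xT|/ltW xT] := leP x T0.
  by rewrite le_max /phi h_initial // xT andbT; lra.
rewrite le_max; apply/orP; right.
have T18x := le_trans T0_ge xT.
have [K [K0 Kx dK]] := tilted_renewal x.
have k0 : 0 <= phi x by rewrite mulr_ge0 ?h_ge0 ?ltW ?scale_gt0.
have hk s : A <= s <= x -> h s <= phi x * (scale s)^-1.
  move=> /andP[As sx]; rewrite ler_pdivlMr ?scale_gt0 //; last by lra.
  by apply: xmax; rewrite in_itv /= As (le_trans sx).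
have E1 := early_increment xT dK.
have E2 : K (x - A) - K A <= 5 / 16 * (phi x * (scale x)^-1).
  apply: middle_increment => // s /andP[As sx]; apply: hk.
  by rewrite As; lra.
have E3 : K x - K (x - A) <= 81 / 128 * (phi x * (scale x)^-1).
  apply: late_increment => // s /andP[As sx]; apply: hk.
  by apply/andP; split; lra.
have gx : g x <= beta2 * (scale x)^-1 by apply: g_le_scale; lra.
have hx : h x = phi x * (scale x)^-1 by rewrite /phi mulfK // gt_eqF // scale_gt0.
have : phi x * (scale x)^-1 <= 19 * C1 * (scale x)^-1.
  have C10 : 0 <= C1 * (scale x)^-1.
    rewrite mulr_ge0 ?invr_ge0 ?(ltW (scale_gt0 d n_gt0 x0)) // /C1.
    by rewrite addr_ge0 ?mulr_ge0 // ltW.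
  have C1E : C1 * (scale x)^-1 = beta2 * (scale x)^-1 +
      21 / 2 * beta2 * A * (scale x)^-1 by rewrite /C1; ring.
  rewrite K0 in E1; rewrite Kx hx in E3; rewrite -mulrA.
  by move: E1 E2 E3 C10 gx; rewrite C1E; lra.
by rewrite ler_pM2r // invr_gt0 scale_gt0.
Qed.

Lemma renewal_decay t : 1 <= t ->
  H t <= Num.max C2 (19 * C1) / scale t * expR (- (a * t)).
Proof.
move=> t1; have s0 : 0 < scale t by apply: scale_gt0 => //; lra.
rewrite expRN ler_pdivlMr ?expR_gt0 // ler_pdivlMr // mulrC.
by rewrite mulrC [H t * _]mulrC; apply: tilted_bound.
Qed.

End RenewalBound.

(** * Lower bound for the heat energy *)

Section TrigBounds.
Context {R : realType}.
Implicit Types x y : R.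

Lemma sin_le_id y : 0 <= y -> sin y <= y.
Proof.
move=> y0; have := @increment_le R sin id cos (fun=> 1) 0 y y0
  (fun u _ => is_derive_sin u) (fun u _ => is_derive_id u 1) (fun u _ => cos_le1 u).
by rewrite sin0 /= !subr0.
Qed.

Lemma one_sub_cosE y : 1 - cos (2 * y) = 2 * sin y ^+ 2.
Proof.
by rewrite mulrC mulr_natr cos_mulr2n cos2sin2; ring.
Qed.

Lemma one_sub_cos_le y : 0 <= y <= 1 -> 1 - cos (2 * y) <= 2 * y ^+ 2.
Proof.
move=> /andP[y0 y1]; rewrite one_sub_cosE ler_wpM2l // lerXn2r ?nnegrE ?sin_le_id //.
by rewrite sin_ge0_pi // y0 (le_trans y1) // (le_trans _ (pi_ge2 R)) // ler1n.
Qed.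

Lemma sin_ge_half y : 0 <= y <= 1 -> y / 2 <= sin y.
Proof.
move=> /andP[y0 y1].
have D u : 0 <= u <= y -> is_derive u 1 (fun u => 2^-1 * u) (2^-1 * 1 : R).
  by move=> _; apply: is_derive_scale; exact: is_derive_id.
have hle u : 0 <= u <= y -> 2^-1 * 1 <= cos u.
  move=> /andP[u0 uy]; rewrite mulr1.
  have : 1 - cos (2 * (u / 2)) <= 2 * (u / 2) ^+ 2.
    by apply: one_sub_cos_le; apply/andP; split; lra.
  rewrite (_ : 2 * (u / 2) = u); last by field.
  have : u ^+ 2 <= 1 by rewrite expr_le1 // (le_trans uy).
  rewrite exprMn exprVn; lra.
have := increment_le y0 D (fun u _ => is_derive_sin u) hle.
by rewrite sin0 mulr0 !subr0 mulrC.
Qed.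

Lemma one_sub_cos_ge y : 0 <= y <= 1 -> y ^+ 2 / 2 <= 1 - cos (2 * y).
Proof.
move=> y01; have /andP[y0 _] := y01; have h := sin_ge_half y01.
rewrite one_sub_cosE; have : (y / 2) ^+ 2 <= sin y ^+ 2.
  by rewrite lerXn2r // nnegrE ?(le_trans _ h) // divr_ge0.
by rewrite exprMn exprVn; lra.
Qed.

Lemma pi_le4 : pi <= 4 :> R.
Proof. by have := pihalf_lt2 R; lra. Qed.

End TrigBounds.

Section TestFunctions.
Context {R : realType} {d n : nat}.
Hypotheses (d_gt0 : (0 < d)%N) (n_gt2 : (2 < n)%N).
Local Notation torus := (torus d n).
Variable p : R -> torus -> R.
Hypotheses (p0 : p 0 = fun i => (i == 0)%:R) (p_flow : flow laplacian p).

Lemma eigenfunction_pairing (phi : torus -> R) (lam t : R) :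
  (forall i, laplacian phi i = - lam * phi i) ->
  \sum_(i : torus) p t i * phi i = expR (- (lam * t)) * phi 0.
Proof.
move=> eig.
pose F u := expR (lam * u) * \sum_(i : torus) p u i * phi i.
have dF (u : R) : is_derive u 1 F 0.
  have d1 : is_derive u 1 (fun u : R => lam * u) (lam * 1).
    by apply: is_derive_scale; exact: is_derive_id.
  have d2 := is_derive1_comp (is_derive_expR (lam * u)) d1.
  have d3 : is_derive u 1 (fun u => \sum_(i : torus) p u i * phi i)
      (\sum_(i : torus) laplacian (p u) i * phi i).
    apply: is_derive_bigsum => i.
    apply: (is_derive_eq (is_derive_mul (p_flow u i) (is_derive_cst (phi i) u 1))).
    by rewrite mulr0 addr0.
  apply: (is_derive_eq (is_derive_mul d2 d3)).
  rewrite laplacian_self_adjoint //.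
  have -> : \sum_(i : torus) p u i * laplacian phi i =
      - lam * \sum_(i : torus) p u i * phi i.
    by rewrite mulr_sumr; apply: eq_bigr => i _; rewrite eig mulrCA.
  by rewrite /=; ring.
have : F t = F 0 by apply: is_derive_0_is_cst.
rewrite /F mulr0 expR0 mul1r p0 => h.
have -> : phi 0 = \sum_(i : torus) (i == 0)%:R * phi i.
  rewrite (bigD1 (0 : torus)) //= eqxx mul1r big1 ?addr0 // => i i0.
  by rewrite (negbTE i0) mul0r.
by rewrite -h mulrA -expRD addNr expR0 mul1r.
Qed.

(** Cauchy-Schwarz against a combination of eigenfunctions bounds the energy
   from below. *)
Lemma heat_energy_ge (J : finType) (lam : J -> R) (phi : J -> torus -> R) (B t : R) :
  (forall j i, laplacian (phi j) i = - lam j * phi j i) -> 0 < B ->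
  \sum_(i : torus) (\sum_j phi j i) ^+ 2 <= B ->
  (\sum_j lam j * expR (- (lam j * t)) * phi j 0) ^+ 2 <= B * heat_energy p t.
Proof.
move=> eig B0 hB; set X := \sum_j _.
have XE : \sum_(i : torus) laplacian (p t) i * (\sum_j phi j i) = - X.
  rewrite laplacian_self_adjoint //.
  transitivity (\sum_(i : torus) \sum_j - lam j * (p t i * phi j i)).
    apply: eq_bigr => i _.
    have := linop_sum (index_enum J) (fun=> 1) phi i linop_laplacian.
    rewrite (_ : (fun k => _) = fun k => \sum_j phi j k); last first.
      by apply/funext => k; apply: eq_bigr => j _; rewrite mul1r.
    move=> ->; rewrite mulr_sumr.
    by apply: eq_bigr => j _; rewrite mul1r eig; ring.
  rewrite exchange_big /= -sumrN; apply: eq_bigr => j _.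
  by rewrite -mulr_sumr (eigenfunction_pairing t (eig j)); ring.
clearbody X.
have : 0 <= \sum_(i : torus) (B * laplacian (p t) i + X * \sum_j phi j i) ^+ 2.
  by apply: sumr_ge0 => i _; exact: sqr_ge0.
have -> : \sum_(i : torus) (B * laplacian (p t) i + X * \sum_j phi j i) ^+ 2 =
    B ^+ 2 * heat_energy p t +
    2 * B * X * (\sum_(i : torus) laplacian (p t) i * (\sum_j phi j i)) +
    X ^+ 2 * \sum_(i : torus) (\sum_j phi j i) ^+ 2.
  rewrite /heat_energy !mulr_sumr -!big_split /=; apply: eq_bigr => i _; ring.
rewrite XE => h.
have h2 : X ^+ 2 * \sum_(i : torus) (\sum_j phi j i) ^+ 2 <= X ^+ 2 * B.
  by rewrite ler_wpM2l // sqr_ge0.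
have h3 : 0 <= B * (B * heat_energy p t - X ^+ 2).
  by move: h h2; rewrite !expr2; lra.
by move: h3; rewrite pmulr_rge0 // subr_ge0.
Qed.

End TestFunctions.

Section FourierModes.
Context {R : realType} {d n : nat}.
Hypotheses (d_gt0 : (0 < d)%N) (n_gt2 : (2 < n)%N).
Local Notation theta := (2 * pi / n%:R : R).

Let n_gt0 : (0 < n)%N. Proof. by apply: leq_trans n_gt2. Qed.
Let n_neq0 : n%:R != 0 :> R. Proof. by rewrite pnatr_eq0 -lt0n. Qed.

Definition mode (m : nat) (y : 'Z_n) : R := cos (theta * m%:R * (y : nat)%:R).

Lemma cos_mod (m a : nat) :
  cos (theta * m%:R * (a %% n)%:R) = cos (theta * m%:R * a%:R).
Proof.
rewrite [in RHS](divn_eq a n) natrD natrM.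
rewrite [X in _ = cos X](_ : _ =
  theta * m%:R * (a %% n)%:R + (pi *+ 2) *+ (m * (a %/ n))).
  by rewrite (periodicn (@cosD2pi R)).
by rewrite -(mulr_natr (pi *+ 2)) -(mulr_natr pi) natrM; field.
Qed.

Lemma val_Zn_add (x y : 'Z_n) : ((x + y)%R : nat) = ((x + y) %% n)%N.
Proof. by rewrite /= [in X in (_ %% X)%N]Zp_cast // ltnW. Qed.

Lemma mode_shift m (y : 'Z_n) :
  mode m (y + 1) + mode m (y - 1) = 2 * cos (theta * m%:R) * mode m y.
Proof.
have [z ->] : exists z, y = z + 1 by exists (y - 1); rewrite subrK.
rewrite addrK -[z + 1 + 1]addrA /mode !val_Zn_add !cos_mod.
have -> : nat_of_ord (1 : 'Z_n) = 1%N.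
  by rewrite /= Zp_cast ?modn_small // ltnW.
rewrite [((1 + 1) %% n)%N]modn_small // !natrD.
have -> : theta * m%:R * (z%:R + (1%:R + 1%:R)) =
  theta * m%:R * (z%:R + 1%:R) + theta * m%:R by ring.
have -> : theta * m%:R * z%:R =
  theta * m%:R * (z%:R + 1%:R) - theta * m%:R by ring.
by rewrite cosD cosB; ring.
Qed.

(** Modes are eigenfunctions, for distinct eigenvalues, of the sum of the two
   opposite shifts, which is self-adjoint. *)
Lemma mode_orthogonal (a b : nat) : (a * 2 <= n)%N -> (b * 2 <= n)%N -> a != b ->
  \sum_y mode a y * mode b y = 0.
Proof.
move=> an bn ab.
have shift_adj : \sum_y (mode a (y + 1) + mode a (y - 1)) * mode b y =
    \sum_y mode a y * (mode b (y + 1) + mode b (y - 1)).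
  under eq_bigr do rewrite mulrDl.
  under [RHS]eq_bigr do rewrite mulrDr.
  rewrite !big_split /= addrC; congr (_ + _).
    rewrite (reindex_inj (addIr 1)) /=.
    by apply: eq_bigr => y _; rewrite addrK.
  rewrite (reindex_inj (addIr (-1))) /=.
  by apply: eq_bigr => y _; rewrite subrK.
have in_range (k : nat) : (k * 2 <= n)%N -> theta * k%:R \in `[0, pi].
  move=> kn; rewrite in_itv /=; apply/andP; split.
    by rewrite !mulr_ge0 ?invr_ge0 // pi_ge0.
  rewrite (_ : theta * k%:R = pi * ((k * 2)%:R / n%:R)); last first.
    by rewrite natrM; field.
  rewrite ler_piMr ?pi_ge0 // ler_pdivrMr ?ltr0n // mul1r ler_nat //.
have : (2 * cos (theta * a%:R) - 2 * cos (theta * b%:R)) *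
    \sum_y mode a y * mode b y = 0.
  rewrite mulrBl !mulr_sumr; apply/eqP; rewrite subr_eq0; apply/eqP.
  transitivity (\sum_y (mode a (y + 1) + mode a (y - 1)) * mode b y).
    by apply: eq_bigr => y _; rewrite mode_shift; ring.
  rewrite shift_adj; apply: eq_bigr => y _; rewrite mode_shift; ring.
move/eqP; rewrite mulf_eq0 -mulrBr mulf_eq0 pnatr_eq0 /= subr_eq0.
case/orP => [/eqP cab|/eqP //]; case/eqP: ab.
have t0 : theta != 0 by rewrite !mulf_neq0 ?invr_eq0 // gt_eqF // pi_gt0.
apply/eqP; rewrite -(eqr_nat R); apply/eqP/(mulfI t0).
by apply: cos_inj => //; exact: in_range.
Qed.

Lemma mode_norm_le m : \sum_y mode m y * mode m y <= n%:R.
Proof.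
apply: (@le_trans _ _ (\sum_(y : 'Z_n) 1)).
  apply: ler_sum => y _.
  by rewrite -expr2 -[leLHS]ger0_norm ?sqr_ge0 // normrX expr_le1 // cos_max.
by rewrite sumr_const card_ord Zp_cast // ltnW.
Qed.

Definition torus_mode (xi : 'I_d -> nat) (x : torus d n) : R :=
  \prod_k mode (xi k) (x k).

Definition torus_freq (xi : 'I_d -> nat) : R :=
  d%:R^-1 * \sum_k (1 - cos (theta * (xi k)%:R)).

Lemma torus_mode_eigen xi x :
  laplacian (torus_mode xi) x = - torus_freq xi * torus_mode xi x.
Proof.
rewrite /laplacian nbr_avgE //.
have step k : torus_mode xi (x + unit_vec k) + torus_mode xi (x - unit_vec k) =
    2 * cos (theta * (xi k)%:R) * torus_mode xi x.
  rewrite /torus_mode (bigD1 k) //= [X in _ + X](bigD1 k) //= [in RHS](bigD1 k) //=.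
  rewrite mulrA -mode_shift mulrDl !ffunE eqxx.
  by congr (_ * _ + _ * _); apply: eq_bigr => l lk;
    rewrite !ffunE (negbTE lk) ?subr0 ?addr0.
under eq_bigr do rewrite step.
rewrite -mulr_suml -mulr_sumr /torus_freq sumrB sumr_const card_ord.
by rewrite -[1 *+ d]/(d%:R); field; rewrite pnatr_eq0 -lt0n.
Qed.

Lemma torus_mode0 xi : torus_mode xi 0 = 1.
Proof. by rewrite /torus_mode big1 // => k _; rewrite /mode ffunE mulr0 cos0. Qed.

End FourierModes.

Section EnergyLowerBound.
Context {R : realType} {d n : nat}.
Hypotheses (d_gt0 : (0 < d)%N) (n_ge16 : (16 <= n)%N).
Local Notation torus := (torus d n).
Local Notation theta := (2 * pi / n%:R : R).
Variable p : R -> torus -> R.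
Hypotheses (p0 : p 0 = fun i => (i == 0)%:R) (p_flow : flow laplacian p).

Let n_gt2 : (2 < n)%N. Proof. exact: leq_trans n_ge16. Qed.
Let n_gt0 : 0 < n%:R :> R. Proof. by rewrite ltr0n; apply: leq_trans n_gt2. Qed.

Let theta_half (a m : nat) : (m <= a)%N -> (a <= 2 * m)%N -> (8 * m <= n)%N ->
  let y : R := pi * a%:R / n%:R in
  [/\ theta * a%:R = 2 * y, 0 <= y <= 1,
     2 * (m%:R / n%:R) <= y & y <= 8 * (m%:R / n%:R)].
Proof.
move=> ma am mn /=; have n0 := n_gt0.
have e (x : R) : x * (m%:R / n%:R) = x * m%:R / n%:R by rewrite mulrA.
have ma' : m%:R <= a%:R :> R by rewrite ler_nat.
have am' : a%:R <= 2 * m%:R :> R by rewrite -natrM ler_nat.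
have mn' : 8 * m%:R <= n%:R :> R by rewrite -natrM ler_nat.
have a0 : 0 <= a%:R :> R by exact: ler0n.
have pl : 2 * m%:R <= pi * a%:R :> R by apply: ler_pM => //; exact: pi_ge2.
have pu : pi * a%:R <= 8 * m%:R :> R.
  rewrite (_ : 8 * m%:R = 4 * (2 * m%:R)); last by ring.
  by apply: ler_pM; rewrite ?pi_ge0 ?pi_le4.
split.
- by field; rewrite gt_eqF.
- rewrite divr_ge0 ?mulr_ge0 ?pi_ge0 //=.
  by rewrite ler_pdivrMr // mul1r (le_trans pu).
- by rewrite e ler_pM2r ?invr_gt0.
- by rewrite e ler_pM2r ?invr_gt0.
Qed.

Let one_freq_bounds (a m : nat) : (m <= a)%N -> (a <= 2 * m)%N -> (8 * m <= n)%N ->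
  (2 * (m%:R / n%:R) ^+ 2 : R) <= 1 - cos (theta * a%:R) <= 128 * (m%:R / n%:R) ^+ 2.
Proof.
move=> ma am mn; have [-> ] := theta_half ma am mn.
set y := pi * _ / _ => y01 yl yu; have /andP[y0 _] := y01.
have x0 : 0 <= m%:R / n%:R :> R by rewrite divr_ge0.
apply/andP; split.
  apply: le_trans (one_sub_cos_ge y01).
  have : (2 * (m%:R / n%:R)) ^+ 2 <= y ^+ 2.
    by rewrite lerXn2r // nnegrE ?mulr_ge0.
  by rewrite exprMn; lra.
apply: (le_trans (one_sub_cos_le y01)).
have : y ^+ 2 <= (8 * (m%:R / n%:R)) ^+ 2.
  by rewrite lerXn2r // nnegrE ?mulr_ge0.
by rewrite exprMn; lra.
Qed.

(** Frequencies of order [m] in every coordinate: at times of order [(n/m)^2]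
   these [m ^ d] modes have not decayed yet. *)
Lemma heat_energy_ge_band (m : nat) (t : R) :
  (0 < m)%N -> (8 * m <= n)%N -> 0 <= t -> t * (m%:R / n%:R) ^+ 2 <= 4 ->
  4 * expR (- 1024) * (m%:R / n%:R) ^+ (d + 4) <= heat_energy p t.
Proof.
move=> m0 mn t0 tm; have n0 := n_gt0.
pose J := {ffun 'I_d -> 'I_m}.
pose xi (j : J) (k : 'I_d) : nat := (m + j k)%N.
pose x := m%:R / n%:R : R.
have x_gt0 : 0 < x by rewrite divr_gt0 // ltr0n.
have freq_bounds (j : J) :
    2 * x ^+ 2 <= torus_freq (n := n) (xi j) <= 128 * x ^+ 2.
  have d0 : 0 < d%:R :> R by rewrite ltr0n.
  rewrite /torus_freq [d%:R^-1 * _]mulrC ler_pdivlMr // ler_pdivrMr //.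
  have lek k : (m + j k <= 2 * m)%N by rewrite mul2n -addnn leq_add2l ltnW.
  have hk k := one_freq_bounds (leq_addr (j k) m) (lek k) mn.
  have cst (c : R) : c * d%:R = \sum_(k < d) c.
    by rewrite sumr_const card_ord mulr_natr.
  rewrite !cst; apply/andP; split; apply: ler_sum => k _.
    by have /andP[h _] := hk k; exact: h.
  by have /andP[_ h] := hk k; exact: h.
have Bpos : 0 < (m%:R * n%:R) ^+ d :> R by rewrite exprn_gt0 // mulr_gt0 // ltr0n.
have := heat_energy_ge n_gt2 p0 p_flow t
  (fun j : J => torus_mode_eigen d_gt0 n_gt2 (xi j)) Bpos.
pose S : R := \sum_(j : J) torus_freq (n := n) (xi j) *
  expR (- (torus_freq (n := n) (xi j) * t)) * torus_mode (xi j) (0 : torus).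
rewrite -/S => hS.
have S_ge : m%:R ^+ d * (2 * x ^+ 2 * expR (- 512)) <= S.
  rewrite [leLHS](_ : _ = \sum_(j : J) 2 * x ^+ 2 * expR (- 512)); last first.
    by rewrite sumr_const card_ffun !card_ord -[RHS]mulr_natl natrX.
  apply: ler_sum => j _.
  have /andP[fl fu] := freq_bounds j.
  rewrite torus_mode0 mulr1; apply: ler_pM; rewrite ?expR_ge0 //.
    by rewrite mulr_ge0 ?exprn_ge0 // ltW.
  rewrite ler_expR lerN2.
  apply: (@le_trans _ _ (128 * x ^+ 2 * t)); first by rewrite ler_wpM2r.
  by move: tm; rewrite -/x; lra.
have sq : (m%:R ^+ d * (2 * x ^+ 2 * expR (- 512))) ^+ 2 <= S ^+ 2.
  have l0 : 0 <= m%:R ^+ d * (2 * x ^+ 2 * expR (- 512)) :> R.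
    by rewrite !mulr_ge0 ?expR_ge0 ?exprn_ge0 // ltW.
  by rewrite lerXn2r // nnegrE // (le_trans l0).
rewrite -(ler_pM2l Bpos); apply: le_trans (hS _).
  apply: le_trans sq.
  rewrite le_eqVlt; apply/orP; left; apply/eqP.
  rewrite (_ : - 1024 = - 512 + - 512); last by ring.
  have xd : m%:R ^+ d = x ^+ d * n%:R ^+ d by rewrite -exprMn divfK // gt_eqF.
  rewrite expRD -/x exprD [(_ * n%:R) ^+ d]exprMn xd.
  by move: (x ^+ d) (n%:R ^+ d) => X N; ring.
(* Expanding the product over the coordinates turns the sum of the modes into a
   product of one-dimensional sums, and the norm into a product of norms. *)
have modes_prod i : \sum_j torus_mode (xi j) i =
    \prod_(k < d) \sum_(j < m) mode (m + j) (i k) :> R.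
  by rewrite bigA_distr_bigA.
under eq_bigr do rewrite modes_prod -prodrXl.
rewrite -(bigA_distr_bigA (fun (k : 'I_d) (y : 'Z_n) =>
  (\sum_(j < m) mode (m + j) y) ^+ 2)) /= prodr_const card_ord.
have sum0 : 0 <= \sum_(y : 'Z_n) (\sum_(j < m) mode (m + j) y) ^+ 2 :> R.
  by apply: sumr_ge0 => y _; exact: sqr_ge0.
rewrite lerXn2r ?nnegrE ?mulr_ge0 //.
under eq_bigr do rewrite expr2 mulr_suml.
rewrite exchange_big /=.
apply: (@le_trans _ _ (\sum_(j < m) n%:R)); last first.
  by rewrite sumr_const card_ord mulr_natl.
apply: ler_sum => j _; under eq_bigr do rewrite mulr_sumr.
rewrite exchange_big (bigD1 j) //= [X in _ + X]big1 ?addr0 => [|l lj].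
  exact: mode_norm_le.
have le2 (a : 'I_m) : ((m + a) * 2 <= n)%N by have := ltn_ord a; move: mn; lia.
by apply: mode_orthogonal => //; rewrite eqn_add2l eq_sym.
Qed.

Lemma gap1_ge : 2 * n%:R ^- 2 <= gap1 n :> R.
Proof.
have := @one_freq_bounds 1 1 _ _ _.
have n8 : (8 * 1 <= n)%N by apply: leq_trans n_ge16.
move=> /(_ isT isT n8) /andP[+ _].
by rewrite /gap1 mulr1 div1r exprVn.
Qed.

(** The test function is the slowest mode, the cosine of the first coordinate. *)
Lemma heat_energy_ge_gap (t : R) :
  4 / d%:R ^+ 2 / n%:R ^+ (d + 4) * expR (- (2 * gap1 n * d%:R^-1 * t))
    <= heat_energy p t.
Proof.
have n0 := n_gt0; have d0 : 0 < d%:R :> R by rewrite ltr0n.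
pose xi (j : 'I_1) (k : 'I_d) : nat := (k == Ordinal d_gt0).
have freq j : torus_freq (n := n) (xi j) = d%:R^-1 * gap1 n :> R.
  rewrite /torus_freq (bigD1 (Ordinal d_gt0)) //= /xi eqxx mulr1 big1 ?addr0 //.
  by move=> k /negbTE ->; rewrite mulr0 cos0 subrr.
have Bpos : 0 < n%:R ^+ d :> R by rewrite exprn_gt0.
have := heat_energy_ge n_gt2 p0 p_flow t
  (fun j : 'I_1 => torus_mode_eigen d_gt0 n_gt2 (xi j)) Bpos.
rewrite big_ord1 freq torus_mode0 mulr1 => h.
rewrite -(ler_pM2l Bpos); apply: le_trans (h _).
  rewrite (_ : - (2 * _ * _ * t) = - (d%:R^-1 * gap1 n * t) + - (d%:R^-1 * gap1 n * t)).
    rewrite expRD; set e := expR _.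
    rewrite [leLHS](_ : _ = d%:R ^- 2 * e ^+ 2 * (2 * n%:R ^- 2) ^+ 2).
      rewrite [leRHS](_ : _ = d%:R ^- 2 * e ^+ 2 * gap1 n ^+ 2).
        have g0 := gap1_ge.
        have l0 : 0 <= 2 * n%:R ^- 2 :> R by rewrite mulr_ge0 // invr_ge0 exprn_ge0.
        apply: ler_wpM2l; first by rewrite mulr_ge0 ?sqr_ge0 // invr_ge0 sqr_ge0.
        by rewrite lerXn2r // nnegrE // (le_trans l0).
      by field; rewrite gt_eqF.
    by rewrite exprD; field; rewrite ?expf_neq0 ?gt_eqF.
  by ring.
apply: (@le_trans _ _ (\sum_(i : torus) 1)).
  apply: ler_sum => i _; rewrite big_ord1 -[leLHS]ger0_norm ?sqr_ge0 // normrX.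
  rewrite expr_le1 // /torus_mode normr_prod prodr_ile1 // => k _.
  by rewrite normr_ge0 cos_max.
by rewrite sumr_const card_ffun !card_ord Zp_cast ?natrX // ltnW.
Qed.

End EnergyLowerBound.

Definition energy_const (R : realType) (d : nat) : R :=
  Num.min (4 * expR (- 1024) / 8 ^+ (d + 4)) (4 / d%:R ^+ 2).

Lemma energy_const_gt0 (R : realType) (d : nat) : (0 < d)%N ->
  0 < energy_const R d.
Proof.
move=> d0; rewrite lt_min; apply/andP; split.
  move: (expR _) (expR_gt0 (- 1024 : R)) => e e0.
  by rewrite divr_gt0 ?exprn_gt0 ?mulr_gt0.
by rewrite divr_gt0 ?exprn_gt0 ?ltr0n.
Qed.

(** Diffusive times are handled by a band of [m] frequencies with [m / n] of order
   [t ^ (-1/2)], later times by the slowest mode alone. *)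
Lemma heat_energy_lower_bound (R : realType) (d n : nat) (p : R -> torus d n -> R)
    (t : R) : (0 < d)%N -> (16 <= n)%N -> 4 * d%:R <= t ->
  p 0 = (fun i => (i == 0)%:R) -> flow laplacian p ->
  energy_const R d / decay_scale d n t * expR (- (2 * gap1 n * d%:R^-1 * t))
    <= heat_energy p t.
Proof.
move=> d0 n16 td p0 pf.
have n0 : (0 < n)%N by apply: leq_trans n16.
have nR : 0 < n%:R :> R by rewrite ltr0n.
have dR : 1 <= d%:R :> R by rewrite ler1n.
have t4 : 4 <= t by lra.
have t0 : 0 < t by lra.
have c0 := energy_const_gt0 R d0.
have sc := scale_gt0 d n0 t0.
have sqE (k : nat) : (Num.sqrt t) ^+ k = t `^ (k%:R / 2).
  by rewrite -powR12_sqrt ?(ltW t0) // -powR_mulrn ?powR_ge0 // -powRrM mulrC.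
have alphaE : t `^ (d%:R / 2 + 2) = Num.sqrt t ^+ (d + 4).
  by rewrite sqE natrD; congr (_ `^ _); field.
have st0 : 0 < Num.sqrt t by rewrite sqrtr_gt0.
have g0 : 0 <= gap1 n :> R by rewrite subr_ge0 cos_le1.
have [tn|nt] := leP t (n%:R ^+ 2).
  have stn : Num.sqrt t <= n%:R.
    by rewrite -(ger0_norm (ltW nR)) -sqrtr_sqr ler_wsqrtr.
  have st2 : 2 <= Num.sqrt t.
    rewrite -[2]ger0_norm // -sqrtr_sqr ler_wsqrtr //.
    by rewrite expr2; lra.
  have scE : decay_scale d n t = Num.sqrt t ^+ (d + 4).
    by rewrite /decay_scale alphaE min_l // lerXn2r // nnegrE ltW.
  pose y := n%:R / (8 * Num.sqrt t).
  have y0 : 0 <= y by rewrite divr_ge0 ?mulr_ge0 // ltW.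
  pose m := (Num.truncn y).+1.
  have /andP[ym my] := truncn_itv y0; rewrite -/m in my.
  have my1 : m%:R <= y + 1 by rewrite /m -natr1 lerD2r.
  have m0 : 0 < m%:R :> R by rewrite ltr0n.
  have y16 : 16 * y <= n%:R.
    rewrite /y mulrCA ger_pMr // ler_pdivrMr ?mulr_gt0 // mul1r; lra.
  have yn : y * (8 * Num.sqrt t) = n%:R by rewrite /y divfK // gt_eqF // mulr_gt0.
  have mn : (8 * m <= n)%N.
    rewrite -(ler_nat R) natrM; have : 16 <= n%:R :> R by rewrite ler_nat.
    by lra.
  have xl : (8 * Num.sqrt t)^-1 <= m%:R / n%:R.
    by rewrite ler_pdivlMr // mulrC ltW.
  have xu : m%:R / n%:R <= 2 / Num.sqrt t.
    rewrite ler_pdivrMr // mulrAC ler_pdivlMr //.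
    apply: (@le_trans _ _ ((y + 1) * Num.sqrt t)); first by rewrite ler_pM2r.
    by lra.
  have tx : t * (m%:R / n%:R) ^+ 2 <= 4.
    apply: (@le_trans _ _ (t * (2 / Num.sqrt t) ^+ 2)).
      by rewrite ler_pM2l // lerXn2r // nnegrE divr_ge0 // ltW.
    rewrite exprMn exprVn sqr_sqrtr ?(ltW t0) // expr2 mulrCA divff ?gt_eqF //.
    by lra.
  apply: le_trans (heat_energy_ge_band d0 n16 p0 pf (ltn0Sn _) mn (ltW t0) tx).
  apply: (@le_trans _ _ (energy_const R d / decay_scale d n t)).
    rewrite ler_piMr ?divr_ge0 ?(ltW c0) ?(ltW sc) //.
    by rewrite expR_le1 oppr_le0 !mulr_ge0 ?invr_ge0 // ltW.
  apply: (@le_trans _ _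
      (4 * expR (- 1024) / 8 ^+ (d + 4) / Num.sqrt t ^+ (d + 4))).
    by rewrite scE ler_pM2r ?invr_gt0 ?exprn_gt0 // ge_min lexx.
  rewrite -mulrA -invfM -exprMn -exprVn.
  move: (expR _) (expR_gt0 (- 1024 : R)) => e e0; rewrite ler_pM2l ?mulr_gt0 //.
  by rewrite lerXn2r // nnegrE ?invr_ge0 ?mulr_ge0 ?divr_ge0 ?(ltW st0).
have scE : decay_scale d n t = n%:R ^+ (d + 4).
  rewrite /decay_scale alphaE min_r // lerXn2r ?nnegrE ?(ltW nR) ?(ltW st0) //.
  rewrite -(ger0_norm (ltW nR)) -sqrtr_sqr ler_wsqrtr // ltW //.
apply: le_trans (heat_energy_ge_gap d0 n16 p0 pf t).
rewrite scE ler_pM2r ?expR_gt0 // ler_pM2r ?invr_gt0 ?exprn_gt0 //.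
by rewrite ge_min lexx orbT.
Qed.

(** * The Euler scheme *)

Section Euler.
Context {R : realType} {I : finType}.
Variables (Phi : (I -> R) -> I -> R) (x : R -> I -> R).
Hypotheses (Phi_lin : linop Phi) (x_flow : flow Phi x).

Lemma flow_bounded (t : R) : 0 <= t -> exists2 B : R, 0 <= B &
  forall s i, 0 <= s <= t -> `|x s i| <= B.
Proof.
move=> t0.
have bnd i : exists b : R, forall s, 0 <= s <= t -> `|x s i| <= b.
  have [|c _ cmax] := EVT_max (f := fun s => `|x s i|) t0.
    apply: continuous_subspaceT => s.
    apply: (@continuous_comp _ _ _ (fun s => x s i) Num.norm).
      exact: (is_derive_continuous (x_flow s i)).
    exact: norm_continuous.
  by exists `|x c i| => s st; apply: cmax; rewrite in_itv.
have [b hb] := choice bnd.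
exists (\sum_i `|b i|); first exact: sumr_ge0.
move=> s i st; apply: (le_trans (hb i s st)); apply: (le_trans (ler_norm _)).
by rewrite (bigD1 i) //= lerDl sumr_ge0.
Qed.

Lemma linop_sub (A : (I -> R) -> I -> R) f g i : linop A ->
  A f i - A g i = A (fun j => f j - g j) i.
Proof.
move=> lA; have := lA (-1) g f i.
rewrite (_ : (fun j => _) = fun j => f j - g j); last first.
  by apply/funext => j; ring.
by move=> ->; ring.
Qed.

Lemma flow_taylor (t : R) : 0 <= t -> exists2 D : R, 0 <= D &
  forall (s h : R) i, 0 <= s -> 0 <= h -> s + h <= t ->
    `|x (s + h) i - x s i - h * Phi (x s) i| <= D * h ^+ 2.
Proof.
move=> t0; have [B B0 hB] := flow_bounded t0.
have [C C0 hC] := linop_bound Phi_lin.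
exists (C * (C * B)); first by rewrite !mulr_ge0.
move=> s h i s0 h0 sht.
have lip u : s <= u <= s + h -> forall j, `|x u j - x s j| <= C * B * h.
  move=> /andP[su ush] j; apply: (@le_trans _ _ (C * B * (u - s))).
    apply: (increment_abs_le su (fun v _ => x_flow v j)) => v /andP[sv vu].
    apply: hC => k; apply: hB; apply/andP; split; lra.
  by rewrite ler_wpM2l ?mulr_ge0 //; lra.
have sh : s <= s + h by lra.
have dF (v : R) : s <= v <= s + h -> is_derive v 1
    (fun u => x u i + (- Phi (x s) i) * u) (Phi (x v) i + (- Phi (x s) i) * 1).
  by move=> _; exact: (is_derive_add (x_flow v i)
    (is_derive_scale (- Phi (x s) i) (is_derive_id v 1))).
have := increment_abs_le sh dF (C := C * (C * B * h)).
rewrite (_ : _ + _ * (s + h) - _ = x (s + h) i - x s i - h * Phi (x s) i);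
  last by ring.
rewrite (_ : _ * (s + h - s) = C * (C * B) * h ^+ 2); last by ring.
apply => v sv; rewrite mulr1 linop_sub //.
by apply: hC; exact: lip.
Qed.

(** Consistency of order two together with stability in the supremum norm. *)
Lemma euler_converges (Psi : R -> (I -> R) -> I -> R) (c t : R) :
  0 <= c -> 0 <= t -> (forall h, linop (Psi h)) ->
  (forall h f (b : R), 0 <= h -> (forall i, `|f i| <= b) ->
     forall i, `|Psi h f i| <= b) ->
  (forall h f (b : R), 0 <= h -> (forall i, `|f i| <= b) ->
     forall i, `|Psi h f i - f i - h * Phi f i| <= c * h ^+ 2 * b) ->
  exists2 D : R, 0 <= D & forall m i, (0 < m)%N ->
    `|iter m (Psi (t / m%:R)) (x 0) i - x t i| <= D / m%:R.
Proof.
move=> c0 t0 lin stable consistent.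
have [B B0 hB] := flow_bounded t0; have [D D0 hD] := flow_taylor t0.
exists ((c * B + D) * t ^+ 2) => [|m i m0].
  by rewrite mulr_ge0 ?addr_ge0 ?mulr_ge0 ?sqr_ge0.
have mR : 0 < m%:R :> R by rewrite ltr0n.
pose h := t / m%:R; have h0 : 0 <= h by rewrite divr_ge0 // ltW.
have mh : m%:R * h = t by rewrite /h mulrC divfK // gt_eqF.
have err : forall r, (r <= m)%N -> forall i,
    `|iter r (Psi h) (x 0) i - x (r%:R * h) i| <= r%:R * ((c * B + D) * h ^+ 2).
  elim=> [|r IH] rm j; first by rewrite !mul0r subrr normr0.
  have rmR : (r%:R + 1) * h <= t by rewrite -mh ler_wpM2r // natr1 ler_nat.
  have rh0 : 0 <= r%:R * h by rewrite mulr_ge0.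
  pose y := x (r%:R * h).
  have e1 := stable h _ _ h0 (IH (ltnW rm)) j.
  have yB k : `|y k| <= B by apply: hB; rewrite rh0 /=; lra.
  have e2 := consistent h y B h0 yB j.
  have e3 : `|x (r%:R * h + h) j - y j - h * Phi y j| <= D * h ^+ 2.
    by apply: hD => //; lra.
  rewrite iterS -natr1 (_ : (r%:R + 1) * h = r%:R * h + h); last by ring.
  move: e1; rewrite -linop_sub // -/y => e1.
  move: e1 e2 e3.
  set a1 := Psi h _ j; set a2 := Psi h y j; set a3 := x _ j.
  rewrite !ler_norml => /andP[l1 u1] /andP[l2 u2] /andP[l3 u3].
  by apply/andP; split; lra.
have := err m (leqnn m) i.
rewrite -/h mh; congr (_ <= _); rewrite /h; field.
by rewrite gt_eqF.
Qed.

End Euler.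

(** * Random subsets and the discrete smoothing chain *)

Section RandomSubset.
Context {R : realType} {I : finType}.
Implicit Types (q : R) (S A : {set I}).

Definition subset_weight q S : R := \prod_k (if k \in S then q else 1 - q).

Lemma subset_weight_ge0 q S : 0 <= q <= 1 -> 0 <= subset_weight q S.
Proof.
move=> /andP[q0 q1]; apply: prodr_ge0 => k _.
by case: ifP => _ //; rewrite subr_ge0.
Qed.

(** Expand the product of the [q + (1 - q) [k notin A]] over all [k]. *)
Lemma subset_weight_superset q A :
  \sum_S subset_weight q S * (A \subset S)%:R = q ^+ #|A|.
Proof.
have -> : q ^+ #|A| = \prod_k (q + (1 - q) * (k \notin A)%:R).
  rewrite -prodr_const big_mkcond; apply: eq_bigr => k _.
  by case: (k \in A); rewrite /= ?mulr0 ?mulr1; ring.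
rewrite bigA_distr; apply: eq_big => [S|S _]; first by rewrite inE.
have [AS|/subsetPn[k kA kS]] := boolP (A \subset S).
  rewrite mulr1; apply: eq_bigr => k _; case: ifPn => // kS.
  by rewrite (contra (fun kA => fintype.subsetP AS k kA) kS) mulr1.
by rewrite mulr0 (bigD1 k) //= (negbTE kS) kA mulr0 mul0r.
Qed.

Lemma subset_weight_sum q : \sum_S subset_weight q S = 1.
Proof.
rewrite -[RHS](expr0 q) -(cards0 I) -subset_weight_superset.
by apply: eq_bigr => S _; rewrite finset.sub0set mulr1.
Qed.

Lemma subset_weight_mem q i :
  \sum_S subset_weight q S * (i \in S)%:R = q.
Proof.
rewrite -[RHS]expr1 -(cards1 i) -subset_weight_superset.
by apply: eq_bigr => S _; rewrite finset.sub1set.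
Qed.

Lemma subset_weight_mem2 q i j :
  \sum_S subset_weight q S * ((i \in S)%:R * (j \in S)%:R) =
  if i == j then q else q ^+ 2.
Proof.
have -> : (if i == j then q else q ^+ 2) = q ^+ #|[set i; j]%SET|.
  by rewrite cards2; case: eqP.
rewrite -subset_weight_superset; apply: eq_bigr => S _.
by rewrite finset.subUset !finset.sub1set -natrM mulnb.
Qed.

(** The most recent subset comes first, so that a new step is a [cons]. *)
Fixpoint histories (m : nat) : seq (seq {set I}) :=
  if m is m'.+1 then [seq A :: x | A <- index_enum {set I}, x <- histories m']
  else [:: [::]].

Definition history_weight q (x : seq {set I}) : R :=
  \prod_(S <- x) subset_weight q S.

Definition history_mean q (m : nat) (F : seq {set I} -> R) : R :=
  \sum_(x <- histories m) history_weight q x * F x.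

Lemma history_mean0 q F : history_mean q 0 F = F [::].
Proof. by rewrite /history_mean big_seq1 /history_weight big_nil mul1r. Qed.

Lemma history_meanS q m F : history_mean q m.+1 F =
  history_mean q m (fun x => \sum_S subset_weight q S * F (S :: x)).
Proof.
rewrite /history_mean /= big_allpairs_dep /= exchange_big /=.
apply: eq_bigr => x _; rewrite mulr_sumr; apply: eq_bigr => S _.
by rewrite /history_weight big_cons; ring.
Qed.

Lemma history_mean_sum q m (J : Type) (s : seq J) (c : J -> R) F :
  history_mean q m (fun x => \sum_(j <- s) c j * F j x) =
  \sum_(j <- s) c j * history_mean q m (F j).
Proof.
rewrite /history_mean; under eq_bigr do rewrite mulr_sumr.
rewrite exchange_big /=; apply: eq_bigr => j _; rewrite mulr_sumr.
by apply: eq_bigr => x _; ring.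
Qed.

Lemma mem_histories m x : (x \in histories m) = (size x == m).
Proof.
elim: m x => [|m IH] [|S x] //=; last first.
  rewrite eqSS -IH; apply/allpairsP/idP => [[[S' x'] /= [_ xm [_ ->]]]|xm] //.
  by exists (S, x); split => //=; rewrite mem_index_enum.
by apply/negbTE/allpairsP => -[[S' x'] /= [_ _]].
Qed.

Lemma uniq_histories m : uniq (histories m).
Proof.
elim: m => //= m IH; apply: allpairs_uniq => //; first exact: index_enum_uniq.
by move=> [S x] [S' x'] _ _ /= [-> ->].
Qed.

End RandomSubset.

Section SmoothingChain.
Context {R : realType} {d n : nat}.
Hypotheses (d_gt0 : (0 < d)%N) (n_gt2 : (2 < n)%N).
Local Notation torus := (torus d n).
Implicit Types (f : torus -> R) (S : {set torus}) (M : torus * torus -> R).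

(** All sites of [S] are averaged at once. This agrees with ringing the clocks of
   [S] whenever [S] has at most one element, and it keeps the coordinates
   independent otherwise. *)
Definition smooth S f (i : torus) : R := f i + (i \in S)%:R * laplacian f i.

Definition smooth_path (x : seq {set torus}) : torus -> R :=
  foldr smooth (fun i => (i == 0)%:R) x.

Lemma smoothE S f i : smooth S f i = if i \in S then nbr_avg f i else f i.
Proof. by rewrite /smooth /laplacian; case: ifP => _; rewrite ?mul0r ?mul1r; ring. Qed.

Lemma smooth_path_bound x i : `|smooth_path x i| <= 1.
Proof.
elim: x i => [|S x IH] i /=; first by case: eqP; rewrite ?normr1 ?normr0.
by rewrite smoothE; case: ifP => _ //; exact: nbr_avg_bound.
Qed.

(** One step of the chain on second moments: on the diagonal both coordinates see
   the same coin, elsewhere two independent ones. *)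
Definition chain_gen (q : R) M (x : torus * torus) : R :=
  M x + q * (lap1 M x + lap2 M x)
  + (if x.1 == x.2 then q else q ^+ 2) * lap1 (lap2 M) x.

Definition chain_moment (q : R) (m : nat) (x : torus * torus) : R :=
  history_mean q m (fun h => smooth_path h x.1 * smooth_path h x.2).

Lemma laplacianZ (c : R) f i : laplacian (fun j => c * f j) i = c * laplacian f i.
Proof.
have := linop_laplacian c f (fun=> 0) i.
rewrite (linop0 _ linop_laplacian) addr0 => <-; congr (laplacian _ i).
by apply/funext => j; rewrite addr0.
Qed.

Lemma lap1_history q m (F G : seq {set torus} -> torus -> R) x :
  lap1 (fun z => history_mean q m (fun h => F h z.1 * G h z.2)) x =
  history_mean q m (fun h => laplacian (F h) x.1 * G h x.2).
Proof.
rewrite /lap1 /history_mean /=.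
rewrite (linop_sum _ _ (fun h i => F h i * G h x.2) _ linop_laplacian).
apply: eq_bigr => h _; congr (_ * _).
rewrite -mulrC -laplacianZ; congr (laplacian _ _).
by apply/funext => j; rewrite mulrC.
Qed.

Lemma lap2_history q m (F G : seq {set torus} -> torus -> R) x :
  lap2 (fun z => history_mean q m (fun h => F h z.1 * G h z.2)) x =
  history_mean q m (fun h => F h x.1 * laplacian (G h) x.2).
Proof.
rewrite /lap2 /history_mean /=.
rewrite (linop_sum _ _ (fun h j => F h x.1 * G h j) _ linop_laplacian).
by apply: eq_bigr => h _; congr (_ * _); rewrite laplacianZ.
Qed.

Lemma lap12_history q m x :
  lap1 (lap2 (chain_moment q m)) x = history_mean q m
    (fun h => laplacian (smooth_path h) x.1 * laplacian (smooth_path h) x.2).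
Proof.
rewrite -(lap1_history q m smooth_path (fun h => laplacian (smooth_path h))).
congr (lap1 _ x).
by apply/funext => z; rewrite -(lap2_history q m smooth_path smooth_path).
Qed.

Lemma chain_momentS q m : chain_moment q m.+1 = chain_gen q (chain_moment q m).
Proof.
apply/funext => -[i j]; rewrite /chain_gen lap12_history.
rewrite (lap1_history q m smooth_path smooth_path).
rewrite (lap2_history q m smooth_path smooth_path) /=.
rewrite /chain_moment history_meanS /=.
rewrite /history_mean -big_split /= mulr_sumr mulr_sumr -!big_split /=.
apply: eq_bigr => h _; set y := smooth_path h; set w := history_weight q h.
rewrite -(subset_weight_mem2 q i j).
transitivity (w * (y i * y j * (\sum_(S : {set torus}) subset_weight q S)
   + y i * laplacian y j * (\sum_(S : {set torus}) subset_weight q S * (j \in S)%:R)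
   + laplacian y i * y j * (\sum_(S : {set torus}) subset_weight q S * (i \in S)%:R)
   + laplacian y i * laplacian y j *
     (\sum_(S : {set torus}) subset_weight q S * ((i \in S)%:R * (j \in S)%:R)))).
  congr (_ * _); rewrite !mulr_sumr -!big_split /=.
  by apply: eq_bigr => S _; rewrite /smooth -/y; ring.
by rewrite subset_weight_sum !subset_weight_mem; ring.
Qed.

Lemma chain_moment_iter q m : chain_moment q m =
  iter m (chain_gen q) (fun x => (x.1 == 0)%:R * (x.2 == 0)%:R).
Proof.
elim: m => [|m IH]; last by rewrite chain_momentS IH.
by apply/funext => x; rewrite /chain_moment history_mean0.
Qed.

Lemma linop_chain_gen q : linop (chain_gen q).
Proof.
by move=> c f g x; rewrite /chain_gen linop_lap12 linop_lap1 linop_lap2; ring.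
Qed.

(** With [A1], [A2] the averages in each variable, the step is a convex combination
   of averages: [(1 - q + q A1) (1 - q + q A2)] off the diagonal and
   [1 - q + q A1 A2] on it. *)
Lemma chain_gen_stable q M (b : R) : 0 <= q <= 1 -> (forall x, `|M x| <= b) ->
  forall x, `|chain_gen q M x| <= b.
Proof.
move=> /andP[q0 q1] hM [i j].
pose A1 N (x : torus * torus) : R := nbr_avg (fun i => N (i, x.2)) x.1.
pose A2 N (x : torus * torus) : R := nbr_avg (fun j => N (x.1, j)) x.2.
have h1 N : (forall x, `|N x| <= b) -> forall x, `|A1 N x| <= b.
  by move=> hN x; apply: nbr_avg_bound => // k; exact: hN.
have h2 N : (forall x, `|N x| <= b) -> forall x, `|A2 N x| <= b.
  by move=> hN x; apply: nbr_avg_bound => // k; exact: hN.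
have l1 : lap1 M (i, j) = A1 M (i, j) - M (i, j) by [].
have l2 x : lap2 M x = A2 M x - M x by case: x.
have l12 : lap1 (lap2 M) (i, j) =
    A1 (A2 M) (i, j) - A1 M (i, j) - A2 M (i, j) + M (i, j).
  rewrite {1}/lap1 {1}/laplacian /= l2.
  have <- : nbr_avg (fun i => lap2 M (i, j)) i = A1 (A2 M) (i, j) - A1 M (i, j).
    rewrite /A1 (linop_sub _ _ _ (linop_nbr_avg (R := R) (d := d) (n := n))) /=.
    by congr (nbr_avg _ i); apply/funext => k; rewrite l2.
  by ring.
have b1 := h1 _ hM (i, j); have b2 := h2 _ hM (i, j); have b0 := hM (i, j).
have b12 := h1 _ (h2 _ hM) (i, j).
rewrite /chain_gen l1 l2 l12 /=.
move: b1 b2 b0 b12; set m1 := A1 M _; set m2 := A2 M _; set m0 := M _.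
set m12 := A1 _ _; rewrite !ler_norml.
move=> /andP[l1' u1] /andP[l2' u2] /andP[l0 u0] /andP[l12' u12].
have q' : 0 <= 1 - q by rewrite subr_ge0.
case: eqP => _.
  rewrite (_ : _ + _ = (1 - q) * m0 + q * m12); last by ring.
  have := ler_wpM2l q' l0; have := ler_wpM2l q' u0.
  have := ler_wpM2l q0 l12'; have := ler_wpM2l q0 u12.
  by move=> *; apply/andP; split; lra.
rewrite (_ : _ + _ = (1 - q) * ((1 - q) * m0 + q * m1) +
   q * ((1 - q) * m2 + q * m12)); last by ring.
have L : - b <= (1 - q) * m0 + q * m1.
  by have := ler_wpM2l q' l0; have := ler_wpM2l q0 l1'; lra.
have U : (1 - q) * m0 + q * m1 <= b.
  by have := ler_wpM2l q' u0; have := ler_wpM2l q0 u1; lra.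
have L' : - b <= (1 - q) * m2 + q * m12.
  by have := ler_wpM2l q' l2'; have := ler_wpM2l q0 l12'; lra.
have U' : (1 - q) * m2 + q * m12 <= b.
  by have := ler_wpM2l q' u2; have := ler_wpM2l q0 u12; lra.
have := ler_wpM2l q' L; have := ler_wpM2l q' U.
have := ler_wpM2l q0 L'; have := ler_wpM2l q0 U'.
by move=> *; apply/andP; split; lra.
Qed.

Lemma ring_prob_bounds (h : R) : 0 <= h ->
  let q := 1 - expR (- h) in [/\ 0 <= q <= 1, q <= h & h - h ^+ 2 <= q].
Proof.
move=> h0 q.
have e1 : 1 - h <= expR (- h) by have := expR_ge1Dx (- h); lra.
have e0 := expR_gt0 (- h).
have e2 : expR (- h) <= 1 by rewrite expR_le1 oppr_le0.
have e3 : expR (- h) * (1 + h) <= 1.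
  by rewrite expRN mulrC ler_pdivrMr ?expR_gt0 // mul1r expR_ge1Dx.
have e4 : expR (- h) <= 1 - h + h ^+ 2.
  have h1 : 0 < 1 + h by lra.
  rewrite -(ler_pM2r h1) (le_trans e3) //.
  rewrite (_ : _ * _ = 1 + h ^+ 3); last by ring.
  by rewrite lerDl exprn_ge0.
by rewrite /q; split; [apply/andP; split|..]; lra.
Qed.

Lemma chain_gen_consistent (h : R) M (b : R) : 0 <= h ->
  (forall x, `|M x| <= b) -> forall x,
  `|chain_gen (1 - expR (- h)) M x - M x - h * moment_gen M x| <= 8 * h ^+ 2 * b.
Proof.
move=> h0 hM [i j]; have [] := ring_prob_bounds h0; set q := 1 - _.
move=> /andP[q0 q1] qh hq.
have b0 : 0 <= b by apply: le_trans (hM (i, j)).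
have b1 : `|lap1 M (i, j)| <= 2 * b by apply: laplacian_bound => // k; exact: hM.
have b2 x : `|lap2 M x| <= 2 * b by apply: laplacian_bound => // k; exact: hM.
have b12 : `|lap1 (lap2 M) (i, j)| <= 2 * (2 * b).
  by apply: laplacian_bound => // k; exact: b2.
have qq : `|q - h| <= h ^+ 2.
  by rewrite ler_norml; apply/andP; split; have := sqr_ge0 h; lra.
have q2 : `|q ^+ 2| <= h ^+ 2 by rewrite normrX lerXn2r ?nnegrE // ger0_norm.
pose c := if i == j then q - h else q ^+ 2.
have hc : `|c| <= h ^+ 2 by rewrite /c; case: ifP.
have -> : chain_gen q M (i, j) - M (i, j) - h * moment_gen M (i, j) =
   (q - h) * (lap1 M (i, j) + lap2 M (i, j)) + c * lap1 (lap2 M) (i, j).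
  rewrite /chain_gen /moment_gen /c /=; case: eqP => _; rewrite ?mul0r ?mul1r; ring.
rewrite (_ : 8 * h ^+ 2 * b = h ^+ 2 * (2 * b + 2 * b) + h ^+ 2 * (2 * (2 * b)));
  last by ring.
apply: (le_trans (ler_normD _ _)); rewrite !normrM.
apply: lerD; apply: ler_pM => //.
by apply: (le_trans (ler_normD _ _)); exact: lerD.
Qed.

Lemma chain_energy_converges (M : R -> torus * torus -> R) (t : R) :
  M 0 = (fun x => (x.1 == 0)%:R * (x.2 == 0)%:R) -> flow moment_gen M -> 0 <= t ->
  exists2 D : R, 0 <= D & forall m, (0 < m)%N ->
    `|history_mean (1 - expR (- (t / m%:R))) m
        (fun h => \sum_(i : torus) laplacian (smooth_path h) i ^+ 2)
      - energy M t| <= D / m%:R.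
Proof.
move=> M0 Mf t0.
have stable (h : R) F (b : R) : 0 <= h -> (forall x, `|F x| <= b) ->
    forall x, `|chain_gen (1 - expR (- h)) F x| <= b.
  by move=> h0; apply: chain_gen_stable; have [] := ring_prob_bounds h0.
have [D D0 hD] := euler_converges linop_moment_gen Mf (ler0n R 8) t0
  (fun h => linop_chain_gen (1 - expR (- h))) stable chain_gen_consistent.
have [C C0 hC] := linop_bound (linop_lap12 (R := R) (d := d) (n := n)).
exists (\sum_(i : torus) C * D); first by apply: sumr_ge0 => i _; rewrite mulr_ge0.
move=> m m0; set q := 1 - _.
have -> : history_mean q m (fun h => \sum_(i : torus) laplacian (smooth_path h) i ^+ 2)
    = \sum_(i : torus) lap1 (lap2 (chain_moment q m)) (i, i).
  transitivity (history_mean q m (fun h => \sum_(i : torus) 1 *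
    (laplacian (smooth_path h) i * laplacian (smooth_path h) i))).
    rewrite /history_mean; apply: eq_bigr => h _; congr (_ * _).
    by apply: eq_bigr => i _; rewrite mul1r expr2.
  rewrite history_mean_sum; apply: eq_bigr => i _.
  by rewrite mul1r lap12_history.
rewrite /energy -sumrB mulr_suml (le_trans (ler_norm_sum _ _ _)) //.
apply: ler_sum => i _; rewrite (linop_sub _ _ _ linop_lap12) -mulrA.
apply: hC => x; rewrite chain_moment_iter -M0; exact: hD.
Qed.

End SmoothingChain.

(** * Sample paths between mesh points *)

Section LastJump.
Context {R : realType}.
Variable N : R -> nat.
Hypotheses (N_mono : forall s t : R, 0 <= s -> s <= t -> (N s <= N t)%N)
  (N_rc : forall t : R, 0 <= t -> \forall u \near t^'+, N u = N t).

(** The last jump before [b] is the infimum of the times at which [N] already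
   has its value at [b]; right continuity puts it among those times. *)
Lemma last_jump (a b : R) : 0 <= a -> a <= b -> (N a < N b)%N ->
  exists u, [/\ a < u <= b, N u = N b &
    forall s, 0 <= s -> s < u -> (N s < N u)%N].
Proof.
move=> a0 ab Nab.
pose E := [set v : R | a <= v <= b /\ N v = N b].
have Eb : E b by split => //; rewrite ab lexx.
have Ea : lbound E a by move=> v [/andP[]].
have hE : has_inf E by split; [exists b|exists a].
pose u := inf E.
have au : a <= u by apply: lb_le_inf => //; exists b.
have ub : u <= b by apply: ge_inf => //; exists a.
have u0 : 0 <= u by apply: le_trans au.
have Nu : N u = N b.
  have [e e0 he] : exists2 e : R, 0 < e & forall v, u < v < u + e -> N v = N u.
    have [e /= e0 he] := N_rc u0; exists e => // v /andP[uv ve].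
    apply: he => //=; rewrite distrC ger0_norm ?subr_ge0 1?ltW //; lra.
  have [v [/andP[av vb] Nv] vu] := inf_adherent e0 hE.
  have uv : u <= v by apply: ge_inf; [exists a|split; rewrite ?av].
  have [->//|neq] := eqVneq u v.
  by rewrite -Nv he // lt_neqAle neq uv.
exists u; split => //.
  rewrite ub andbT lt_neqAle au andbT; apply/eqP => ua.
  by move: Nab; rewrite ua Nu ltnn.
move=> s s0 su; have := N_mono s0 (ltW su); rewrite leq_eqVlt => /orP[/eqP Ns|//].
have sa : s < a.
  rewrite ltNge; apply/negP => sa.
  have : u <= s.
    apply: ge_inf; first by exists a.
    by split; [rewrite sa (le_trans (ltW su))|rewrite Ns].
  by rewrite leNgt su.
by rewrite (leq_ltn_trans (N_mono s0 (ltW sa))) // Nu.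
Qed.

End LastJump.

Section PathwiseSmoothing.
Context {R : realType} {d n : nat} {dT : measure_display} {T : measurableType dT}.
Hypotheses (d_gt0 : (0 < d)%N) (n_gt2 : (2 < n)%N).
Local Notation torus := (torus d n).
Variables (N : torus -> R -> T -> nat) (Y : torus -> R -> T -> R) (w : T).

(** What a single sample path needs to satisfy for the pathwise argument; almost
   every path does. *)
Record regular_path : Prop := RegularPath {
  path_mono : forall k (s t : R), 0 <= s -> s <= t -> (N k s w <= N k t w)%N;
  path_rc : forall k (t : R), 0 <= t -> \forall u \near t^'+, N k u w = N k t w;
  path_ring : forall k (t : R), rings (N k) t w ->
    Y k t w = nbr_avg (fun j => lim (Y j u w @[u --> t^'-])) k;
  path_const : forall k (s t : R), 0 <= s -> s <= t ->
    (forall u, s < u -> u <= t -> ~ rings (N k) u w) -> Y k t w = Y k s w;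
  path_start : forall k, Y k 0 w = (k == 0)%:R }.

Hypothesis path : regular_path.

Definition rung (a b : R) : {set torus} := finset (fun k => (N k a w < N k b w)%N).

Lemma unrung_const k (a b u : R) : 0 <= a -> a <= u -> u <= b ->
  k \notin rung a b -> Y k u w = Y k a w.
Proof.
move=> a0 au ub; rewrite inE -leqNgt => Nba.
apply: (path_const path) => // v av vu [_ /(_ a a0 av)].
rewrite ltnNge (leq_trans (path_mono path k _ _) Nba) //.
  by apply: le_trans a0 (ltW av).
by apply: le_trans ub.
Qed.

(** If a single clock rings in the interval, possibly several times, the values at
   the neighbors are constant, so only its last ring matters. *)
Lemma smooth_interval (a b : R) : 0 <= a -> a < b -> (#|rung a b| <= 1)%N ->
  forall k, Y k b w = smooth (rung a b) (fun j => Y j a w) k.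
Proof.
move=> a0 ab single k; rewrite smoothE; case: ifPn => kab; last first.
  exact: (unrung_const _ (ltW ab) (lexx b)).
have others j : j != k -> j \notin rung a b.
  move=> jk; apply/negP => jab; move: single.
  by rewrite leqNgt; case/negP; apply/card_gt1P; exists j, k; split.
have := kab; rewrite inE => Nab.
have [u [/andP[au ub] Nub Nu]] := last_jump (path_mono path k) (path_rc path k)
  a0 (ltW ab) Nab.
have u0 : 0 < u by apply: le_lt_trans au.
have -> : Y k b w = Y k u w.
  apply: (path_const path) => //; first exact: ltW.
  move=> v uv vb [_ /(_ u (ltW u0) uv)].
  by rewrite ltnNge Nub (path_mono path) // (le_trans (ltW u0) (ltW uv)).
rewrite (path_ring path); last by split.
apply: eq_nbr_avg => // j /others jab.
apply: lim_near_cst => //; near=> v.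
have av : a < v by near: v; exact: nbhs_left_gt.
have vu : v < u by near: v; exact: nbhs_left_lt.
by apply: (unrung_const _ (ltW av) _ jab) => //; rewrite (le_trans (ltW vu)).
Unshelve. all: by end_near. Qed.

(** The order is that of [histories]. *)
Fixpoint rung_history (h : R) (m : nat) : seq {set torus} :=
  if m is m'.+1 then rung (m'%:R * h) (m'.+1%:R * h) :: rung_history h m'
  else [::].

Lemma smooth_path_history (h : R) m : 0 < h ->
  all (fun S : {set torus} => (#|S| <= 1)%N) (rung_history h m) ->
  forall k, Y k (m%:R * h) w = smooth_path (rung_history h m) k.
Proof.
move=> h0; elim: m => [|m IH] /=.
  by move=> _ k; rewrite mul0r (path_start path).
move=> /andP[single good] k.
rewrite (smooth_interval (a := m%:R * h)) //.
- by congr (smooth _ _ k); apply/funext => j; exact: IH.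
- by rewrite mulr_ge0 // ltW.
- by rewrite ltr_pM2r // ltr_nat.
Qed.

End PathwiseSmoothing.

(** * Law of the ringing sets *)

Section HistoryLaw.
Context {R : realType} {d n : nat} {dT : measure_display} {T : measurableType dT}
  (P : probability T R).
Local Notation torus := (torus d n).

Lemma measurable_nat_rel {d' : measure_display} (T' : measurableType d')
    (f g : T' -> nat) (Q : nat -> nat -> Prop) :
  (forall i, measurable (f @^-1` [set i])) ->
  (forall i, measurable (g @^-1` [set i])) ->
  measurable [set w | Q (f w) (g w)].
Proof.
move=> mf mg.
rewrite (_ : [set w | _] = \bigcup_i \bigcup_j
    (if `[< Q i j >] then f @^-1` [set i] `&` g @^-1` [set j] else set0)).
  apply: bigcupT_measurable => i; apply: bigcupT_measurable => j.
  by case: ifP => _ //; exact: measurableI.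
apply/seteqP; split => w /=.
  by move=> h; exists (f w) => //; exists (g w) => //; rewrite asboolT.
by move=> [i _ [j _]]; case: asboolP => // h /= [-> ->].
Qed.

Variables (N : torus -> R -> {RV P >-> nat}) (Y : torus -> R -> {RV P >-> R}).
Hypothesis smoothing : smoothing_process N Y.

Let N' k (t : R) : T -> nat := N k t.

Definition clock_event (m : nat) (h : R) (sigma : nat -> bool) (k : torus) : set T :=
  [set w | forall r, (r < m)%N ->
     (N k (r%:R * h) w < N k (r.+1%:R * h) w)%N = sigma r].

Lemma measurable_preimage_clock k (t : R) i : measurable (N' k t @^-1` [set i]).
Proof.
by rewrite -[X in measurable X]setTI; apply: (measurable_funP (N k t)).
Qed.

(** Independence of the clocks is a statement about the sigma-algebras that they
   generate, so measurability in the ambient space would not be enough. *)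
Lemma clock_event_generated m (h : R) sigma k : 0 < h ->
  generated_sigma [set t : R | 0 <= t] (N' k) (clock_event m h sigma k).
Proof.
move=> h0; rewrite /generated_sigma; set G := \bigcup_(s in _) _.
have mN (t : R) i : 0 <= t ->
    measurable (N' k t @^-1` [set i] : set (g_sigma_algebraType G)).
  move=> t0; apply: sub_sigma_algebra; exists t => //.
  by exists [set i] => //; rewrite setTI.
suff : measurable (clock_event m h sigma k : set (g_sigma_algebraType G)) by [].
rewrite (_ : clock_event m h sigma k = \bigcap_r [set w : g_sigma_algebraType G |
    (r < m)%N -> (N k (r%:R * h) w < N k (r.+1%:R * h) w)%N = sigma r]).
  apply: bigcapT_measurable => r.
  apply: (measurable_nat_rel (T' := g_sigma_algebraType G)
    (f := N' k (r%:R * h)) (g := N' k (r.+1%:R * h))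
    (fun a b => (r < m)%N -> (a < b)%N = sigma r)) => i;
  by apply: mN; rewrite mulr_ge0 // ltW.
by apply/seteqP; split => w /= hw r; [move=> _|]; apply: hw.
Qed.

Let clock k : poisson_process (N k) := smoothing_clocks smoothing k.

Lemma no_ring_probability k (r : nat) (h : R) : 0 < h ->
  P [set w | (N k (r%:R * h) w < N k (r.+1%:R * h) w)%N = false] =
  (expR (- h))%:E.
Proof.
move=> h0.
have := @poisson_increments_law _ _ _ _ _ (clock k) (r%:R * h) (r.+1%:R * h) 0.
rewrite /poisson_pmf expr0 fact0 invr1 !mul1r.
have -> : r.+1%:R * h - r%:R * h = h by rewrite -natr1; ring.
rewrite h0 => <-; last 2 first.
- by rewrite mulr_ge0 // ltW.
- by rewrite ltr_pM2r // ltr_nat.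
congr (P _); apply/seteqP; split => w /=.
  by move=> /negbT; rewrite -leqNgt => /eqP.
by move=> /eqP le; rewrite ltnNge; apply/negbF.
Qed.

Lemma ring_probability k (r : nat) (h : R) (b : bool) : 0 < h ->
  P [set w | (N k (r%:R * h) w < N k (r.+1%:R * h) w)%N = b] =
  (if b then 1 - expR (- h) else 1 - (1 - expR (- h)))%:E.
Proof.
move=> h0; case: b; last first.
  by rewrite no_ring_probability // opprB addrCA subrr addr0.
have mA : measurable [set w | (N k (r%:R * h) w < N k (r.+1%:R * h) w)%N = false].
  apply: (measurable_nat_rel (T' := T) (f := N' k (r%:R * h)) (g := N' k (r.+1%:R * h))
    (fun a b => (a < b)%N = false)) => i; exact: measurable_preimage_clock.
rewrite (_ : [set w | _ = true] =
    ~` [set w | (N k (r%:R * h) w < N k (r.+1%:R * h) w)%N = false]).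
  by rewrite probability_setC // no_ring_probability // EFinB.
apply/seteqP; split => w /=; first by move=> ->.
by case: (N k _ w < _)%N.
Qed.

Lemma clock_event_probability m (h : R) sigma k : 0 < h ->
  P (clock_event m h sigma k) =
  (\prod_(r < m) (if sigma r then 1 - expR (- h) else 1 - (1 - expR (- h))))%:E.
Proof.
move=> h0; pose s (r : nat) : R := r%:R * h.
have s00 : 0 <= s 0%N by rewrite /s mul0r.
have sS r : s r <= s r.+1 by rewrite /s ler_pM2r // ler_nat.
have indep := @poisson_increments_indep _ _ _ _ _ (clock k) m s s00 sS.
pose A (i : 'I_m) := [set w | (N k (s i) w < N k (s i.+1) w)%N = sigma i].
have := indep finset.setT A.
rewrite (_ : \bigcap_(i in _) A i = clock_event m h sigma k); last first.
  apply/seteqP; split => w /=.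
    by move=> hw r rm; have := hw (Ordinal rm); apply; rewrite /= inE.
  by move=> hw i _; exact: hw.
move=> ->; last first.
  move=> i _; exists [set v | (0 < v)%N = sigma i] => //.
  by rewrite setTI; apply/seteqP; split => w /=; rewrite subn_gt0.
rewrite -prodEFin; apply: eq_big => [i|i _]; first by rewrite inE.
exact: ring_probability.
Qed.

Let rung' w := rung (fun k (t : R) => N' k t) w.

(** The probability factors over the clocks, and for each clock over the mesh
   intervals; the two products are then exchanged. *)
Lemma history_event_probability m (h : R) (sigma : nat -> {set torus}) : 0 < h ->
  P [set w | forall r, (r < m)%N -> rung' w (r%:R * h) (r.+1%:R * h) = sigma r] =
  (\prod_(r < m) subset_weight (1 - expR (- h)) (sigma r))%:E.
Proof.
move=> h0.
pose A (o : option torus) : set T :=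
  if o is Some k then clock_event m h (fun r => k \in sigma r) k else setT.
have := @smoothing_indep _ _ _ _ _ _ _ _ smoothing (Some @: finset.setT) A.
rewrite (_ : \bigcap_(i in _) A i = [set w | forall r, (r < m)%N ->
    rung' w (r%:R * h) (r.+1%:R * h) = sigma r]); last first.
  apply/seteqP; split => w /= hw.
    move=> r rm; apply/setP => k; rewrite inE.
    by have := hw (Some k); apply => //=; apply: imset_f; rewrite inE.
  move=> o /= /imsetP[k _ ->] r rm.
  by have /setP/(_ k) := hw r rm; rewrite inE.
move=> ->; last first.
  by move=> o /imsetP[k _ ->] /=; exact: clock_event_generated.
rewrite big_imset /=; last by move=> k l _ _ [].
under eq_bigr do rewrite clock_event_probability //.
rewrite prodEFin exchange_big /=; congr (_%:E); apply: eq_bigr => r _.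
by rewrite /subset_weight; apply: eq_bigl => k; rewrite inE.
Qed.

End HistoryLaw.

(** * The expected energy of the process *)

Section HistoryMeans.
Context {R : realType} {I : finType}.
Implicit Types (q : R) (S : {set I}).

Lemma history_weight_ge0 q (x : seq {set I}) : 0 <= q <= 1 ->
  0 <= history_weight q x.
Proof. by move=> q01; apply: prodr_ge0 => S _; exact: subset_weight_ge0. Qed.

Lemma history_mean_le q m (F G : seq {set I} -> R) : 0 <= q <= 1 ->
  (forall x, F x <= G x) -> history_mean q m F <= history_mean q m G.
Proof.
by move=> q01 FG; apply: ler_sum => x _; rewrite ler_wpM2l ?history_weight_ge0.
Qed.

Lemma history_mean_ge0 q m (F : seq {set I} -> R) : 0 <= q <= 1 ->
  (forall x, 0 <= F x) -> 0 <= history_mean q m F.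
Proof.
by move=> q01 F0; apply: sumr_ge0 => x _; rewrite mulr_ge0 ?history_weight_ge0.
Qed.

Lemma history_meanD q m (F G : seq {set I} -> R) (c : R) :
  history_mean q m (fun x => F x + c * G x) =
  history_mean q m F + c * history_mean q m G.
Proof.
rewrite /history_mean mulr_sumr -big_split /=.
by apply: eq_bigr => x _; ring.
Qed.

(** A count rather than an event, because means of counts add up over the
   intervals; the bound [1] in [crowdedP] recovers the event. *)
Definition crowded (x : seq {set I}) : R := \sum_(S <- x) (1 < #|S|)%N%:R.

Lemma crowded_ge0 x : 0 <= crowded x.
Proof. exact: sumr_ge0. Qed.

Lemma crowdedP x : (all (fun S : {set I} => (#|S| <= 1)%N) x) \/ 1 <= crowded x.
Proof.
elim: x => [|S x [IH|IH]]; first by left.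
  have [S1|S1] := leqP #|S| 1; first by left; rewrite /= S1.
  by right; rewrite /crowded big_cons S1 lerDl crowded_ge0.
by right; rewrite /crowded big_cons (le_trans IH) // lerDr.
Qed.

(** Two given clocks ring in the same interval with probability [q ^ 2]; the bound
   is the union over pairs and intervals. *)
Lemma crowded_mean_le q m : 0 <= q <= 1 ->
  history_mean q m crowded <= m%:R * (#|I| ^ 2)%:R * q ^+ 2.
Proof.
move=> q01; have /andP[q0 q1] := q01.
have mean1 k : history_mean q k (fun _ : seq {set I} => 1) = 1.
  elim: k => [|k IH]; first by rewrite history_mean0.
  rewrite history_meanS -[RHS]IH; apply: eq_bigr => x _; congr (_ * _).
  by under eq_bigr do rewrite mulr1; exact: subset_weight_sum.
pose kappa := \sum_(S : {set I}) subset_weight q S * (1 < #|S|)%N%:R.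
have -> : history_mean q m crowded = m%:R * kappa.
  elim: m => [|k IH]; first by rewrite history_mean0 /crowded big_nil mul0r.
  rewrite history_meanS -natr1 mulrDl mul1r -IH -[kappa]mulr1 -(mean1 k).
  rewrite -history_meanD; apply: eq_bigr => x _; congr (_ * _).
  transitivity (\sum_(S : {set I}) (subset_weight q S * (1 < #|S|)%N%:R +
      subset_weight q S * crowded x)).
    by apply: eq_bigr => S _; rewrite /crowded big_cons; ring.
  by rewrite big_split /= -mulr_suml subset_weight_sum mul1r mulr1 addrC.
rewrite -mulrA ler_wpM2l //.
pose pairs S : R :=
  \sum_(i : I) \sum_(j | j != i) ((i \in S)%:R * (j \in S)%:R).
apply: (@le_trans _ _ (\sum_(S : {set I}) subset_weight q S * pairs S)).
  apply: ler_sum => S _; rewrite ler_wpM2l ?subset_weight_ge0 //.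
  have nn i j : 0 <= (i \in S)%:R * (j \in S)%:R :> R by rewrite mulr_ge0.
  case: card_gt1P => [[i [j [iS jS ij]]]|_]; last first.
    by do 2 (apply: sumr_ge0 => ? _).
  rewrite /pairs (bigD1 i) //= (bigD1 j) 1?eq_sym //= iS jS mulr1 -addrA lerDl.
  by rewrite addr_ge0 ?sumr_ge0 // => k _; rewrite sumr_ge0.
rewrite /pairs; under eq_bigr do rewrite mulr_sumr.
rewrite exchange_big /=.
apply: (@le_trans _ _ (\sum_(i : I) \sum_(j : I) q ^+ 2)); last first.
  by rewrite !sumr_const -mulrnA mulnn mulr_natl.
apply: ler_sum => i _.
under eq_bigr do rewrite mulr_sumr.
rewrite exchange_big /= [leRHS](bigID (fun j => j != i)) /= ler_wpDr //.
  by apply: sumr_ge0 => j _; rewrite sqr_ge0.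
apply: ler_sum => j ji; rewrite subset_weight_mem2.
by rewrite eq_sym (negbTE ji).
Qed.

Definition history_of (sigma : nat -> {set I}) : nat -> seq {set I} :=
  fix h m := if m is m'.+1 then sigma m' :: h m' else [::].

Lemma eq_history_of sigma tau m :
  history_of sigma m = history_of tau m <-> forall r, (r < m)%N -> sigma r = tau r.
Proof.
elim: m => [|m IH] /=; first by split.
split=> [[e /IH h] r|h].
  by rewrite ltnS leq_eqVlt => /orP[/eqP ->|/h].
by congr (_ :: _); [exact: h|apply/IH => r rm; apply: h; exact: ltnW].
Qed.

Lemma history_of_surj m (x : seq {set I}) : size x = m ->
  exists sigma, history_of sigma m = x.
Proof.
elim: m x => [|m IH] [|S x] //=; first by exists (fun=> finset.set0).
move=> [/IH[sigma <-]]; exists (fun r => if r == m then S else sigma r).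
rewrite eqxx; congr (_ :: _); apply/eq_history_of => r rm.
by rewrite ltn_eqF.
Qed.

Lemma size_history_of sigma m : size (history_of sigma m) = m.
Proof. by elim: m => //= m ->. Qed.

Lemma history_weight_of q sigma m :
  history_weight q (history_of sigma m) = \prod_(r < m) subset_weight q (sigma r).
Proof.
rewrite /history_weight; elim: m => [|m IH] /=; first by rewrite big_nil big_ord0.
by rewrite big_cons IH big_ord_recr /= mulrC.
Qed.

End HistoryMeans.

Section HistoryIntegral.
Context {R : realType} {d n : nat} {dT : measure_display} {T : measurableType dT}
  (P : probability T R).
Local Notation torus := (torus d n).
Variables (N : torus -> R -> {RV P >-> nat}) (Y : torus -> R -> {RV P >-> R}).
Hypothesis smoothing : smoothing_process N Y.

Definition mesh_history (h : R) (m : nat) (w : T) : seq {set torus} :=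
  rung_history (fun k (t : R) => N k t : T -> nat) w h m.

Lemma mesh_historyE h m w : mesh_history h m w = history_of
  (fun r => rung (fun k (t : R) => N k t : T -> nat) w (r%:R * h) (r.+1%:R * h)) m.
Proof. by rewrite /mesh_history; elim: m => //= m ->. Qed.

Lemma measurable_mesh_history h m x : 0 < h ->
  measurable [set w | mesh_history h m w = x].
Proof.
move=> h0; have [sx|sx] := eqVneq (size x) m; last first.
  rewrite (_ : [set w | _] = set0) //; apply/seteqP; split => w //= e.
  by case/eqP: sx; rewrite -e mesh_historyE size_history_of.
have [sigma <-] := history_of_surj sx.
rewrite (_ : [set w | _] = \bigcap_(k in [set: torus])
    clock_event N m h (fun r => k \in sigma r) k).
  apply: fin_bigcap_measurable; first exact: finite_finset.
  move=> k _; rewrite (_ : clock_event _ _ _ _ _ = \bigcap_r [set w |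
    (r < m)%N -> (N k (r%:R * h) w < N k (r.+1%:R * h) w)%N = (k \in sigma r)]).
    apply: bigcapT_measurable => r.
    apply: (measurable_nat_rel (T' := T) (f := N k (r%:R * h))
      (g := N k (r.+1%:R * h))
      (fun a b => (r < m)%N -> (a < b)%N = (k \in sigma r))) => i;
    exact: measurable_preimage_clock.
  by apply/seteqP; split => w /= hw r; [move=> _|]; apply: hw.
apply/seteqP; split => w /=; rewrite mesh_historyE.
  by move=> /eq_history_of hw k _ r rm; rewrite -hw // inE.
move=> hw; apply/eq_history_of => r rm; apply/setP => k.
by rewrite inE; exact: hw.
Qed.

Lemma mesh_history_probability h m x : 0 < h -> size x = m ->
  P [set w | mesh_history h m w = x] = (history_weight (1 - expR (- h)) x)%:E.
Proof.
move=> h0 /history_of_surj[sigma <-].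
rewrite history_weight_of -(history_event_probability smoothing) //.
congr (P _); apply/seteqP; split => w /=; rewrite mesh_historyE.
  by move/eq_history_of.
by move=> hw; apply/eq_history_of.
Qed.

Lemma mesh_history_sum (F : seq {set torus} -> R) h m w :
  F (mesh_history h m w) = \sum_(x <- histories m)
    F x * \1_[set w | mesh_history h m w = x] w.
Proof.
have hin : mesh_history h m w \in histories m.
  by rewrite mem_histories mesh_historyE size_history_of.
rewrite (bigD1_seq _ hin (uniq_histories m)) /= indicE mem_set // mulr1.
rewrite big1 ?addr0 // => x xw; rewrite indicE memNset ?mulr0 //= => e.
by rewrite e eqxx in xw.
Qed.

Lemma measurable_of_mesh_history (F : seq {set torus} -> R) h m : 0 < h ->
  measurable_fun setT (fun w => F (mesh_history h m w)).
Proof.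
move=> h0; rewrite (_ : (fun w => _) = fun w => \sum_(x <- histories m)
    F x * \1_[set w | mesh_history h m w = x] w); last first.
  by apply/funext => w; exact: mesh_history_sum.
apply: measurable_sum => x; apply: measurable_funM; first exact: measurable_cst.
exact/measurable_indic/measurable_mesh_history.
Qed.

Lemma integral_mesh_history (F : seq {set torus} -> R) h m : 0 < h ->
  (forall x, 0 <= F x) ->
  (\int[P]_w (F (mesh_history h m w))%:E =
   (history_mean (1 - expR (- h)) m F)%:E)%E.
Proof.
move=> h0 F0.
under eq_integral do rewrite mesh_history_sum -sumEFin.
have mI x : measurable_fun setT
    (fun w => (F x * \1_[set w | mesh_history h m w = x] w)%:E).
  apply/measurable_EFinP/measurable_funM; first exact: measurable_cst.
  exact/measurable_indic/measurable_mesh_history.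
rewrite ge0_integral_sum //; last first.
  by move=> x w _; rewrite lee_fin mulr_ge0.
rewrite /history_mean -sumEFin big_seq [RHS]big_seq; apply: eq_bigr => x.
rewrite mem_histories => /eqP sx.
under eq_integral do rewrite EFinM.
rewrite ge0_integralZl_EFin //; last first.
  exact/measurable_EFinP/measurable_indic/measurable_mesh_history.
rewrite integral_indic //; last exact: measurable_mesh_history.
rewrite setIT mulrC EFinM; congr (_ * _)%E.
exact: mesh_history_probability.
Qed.

End HistoryIntegral.

Lemma le0_of_le_div_nat (R : realType) (x K : R) :
  (forall m : nat, (0 < m)%N -> x <= K / m%:R) -> x <= 0.
Proof.
move=> h; rewrite leNgt; apply/negP => x0.
have K0 : 0 <= K / x.
  have := h 1%N isT; rewrite divr1 => xK.
  by rewrite divr_ge0 ?(ltW x0) // (le_trans (ltW x0)).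
have /andP[_] := truncn_itv K0; rewrite ltr_pdivrMr // => Kx.
have := h _ (ltn0Sn (Num.truncn (K / x))).
by rewrite ler_pdivlMr ?ltr0n // leNgt mulrC Kx.
Qed.

Lemma ae_forall_fin (R : realType) (dT : measure_display) (T : measurableType dT)
    (P : probability T R) (I : finType) (Q : I -> T -> Prop) :
  (forall i, {ae P, forall w, Q i w}) -> {ae P, forall w, forall i, Q i w}.
Proof.
move=> hQ.
have h (s : seq I) : {ae P, forall w, forall i, i \in s -> Q i w}.
  elim: s => [|j s IH]; first by apply: aeW => w i.
  apply: filterS2 (hQ j) IH => w qj qs i; rewrite inE => /orP[/eqP ->|] //.
  exact: qs.
apply: filterS (h (enum I)) => w hw i.
by apply: hw; rewrite mem_enum.
Qed.

Section ExpectedEnergy.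
Context {R : realType} {d n : nat} {dT : measure_display} {T : measurableType dT}
  (P : probability T R).
Hypotheses (d_gt0 : (0 < d)%N) (n_gt2 : (2 < n)%N).
Local Notation torus := (torus d n).
Variables (N : torus -> R -> {RV P >-> nat}) (Y : torus -> R -> {RV P >-> R}).
Hypotheses (smoothing : smoothing_process N Y) (start : started_from_unit_mass Y).

Let N' k (t : R) : T -> nat := N k t.
Let Y' k (t : R) : T -> R := Y k t.

Lemma ae_regular_path : {ae P, forall w, regular_path N' Y' w}.
Proof.
have clock := smoothing_clocks smoothing.
have h1 := ae_forall_fin (fun k => poisson_nondecreasing (clock k)).
have h2 := ae_forall_fin (fun k => poisson_right_continuous (clock k)).
near=> w; split.
- by near: w.
- by near: w.
- by near: w; exact: (smoothing_ring smoothing).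
- by near: w; exact: (smoothing_const smoothing).
- by near: w.
Unshelve. all: by end_near. Qed.

Definition path_energy (x : seq {set torus}) : R :=
  \sum_(i : torus) laplacian (smooth_path x) i ^+ 2.

Let total t w : R := \sum_(i : torus) discrepancy Y i t w ^+ 2.
Let C : R := \sum_(i : torus) 4.

Lemma path_energy_le x : path_energy x <= C.
Proof.
apply: ler_sum => i _; rewrite -[leLHS]ger0_norm ?sqr_ge0 // normrX.
rewrite (_ : 4 = (2 * 1) ^+ 2); last by ring.
rewrite lerXn2r ?nnegrE //.
by apply: laplacian_bound => // j; exact: smooth_path_bound.
Qed.

Lemma path_energy_ge0 x : 0 <= path_energy x.
Proof. by apply: sumr_ge0 => i _; exact: sqr_ge0. Qed.

Lemma total_ge0 t w : 0 <= total t w.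
Proof. by apply: sumr_ge0 => i _; exact: sqr_ge0. Qed.

Lemma total_of_history (t : R) m w : 0 < t -> (0 < m)%N -> regular_path N' Y' w ->
  all (fun S : {set torus} => (#|S| <= 1)%N) (mesh_history N (t / m%:R) m w) ->
  total t w = path_energy (mesh_history N (t / m%:R) m w).
Proof.
move=> t0 m0 path good; have mR : 0 < m%:R :> R by rewrite ltr0n.
have h0 : 0 < t / m%:R by rewrite divr_gt0.
have YE := smooth_path_history path h0 good.
apply: eq_bigr => i _; congr (_ ^+ 2); congr (laplacian _ i).
apply/funext => j; rewrite -YE /Y'; congr (Y j _ w).
by rewrite mulrC divfK // gt_eqF.
Qed.

Lemma crowded_mesh_mean (t : R) m : 0 < t -> (0 < m)%N ->
  history_mean (I := torus) (1 - expR (- (t / m%:R))) m crowded <=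
  (#|torus| ^ 2)%:R * t ^+ 2 / m%:R.
Proof.
move=> t0 m0; have mR : 0 < m%:R :> R by rewrite ltr0n.
have h0 : 0 <= t / m%:R by rewrite divr_ge0 // ltW.
have [q01 qh _] := ring_prob_bounds h0; have /andP[q0 _] := q01.
apply: (le_trans (crowded_mean_le _ q01)).
rewrite [leRHS](_ : _ = m%:R * (#|torus| ^ 2)%:R * (t / m%:R) ^+ 2).
  by rewrite ler_wpM2l ?mulr_ge0 // lerXn2r // nnegrE.
by field; rewrite gt_eqF.
Qed.

(** Almost surely some mesh separates the rings of different clocks. *)
Lemma ae_total_le (t : R) : 0 < t -> {ae P, forall w, total t w <= C}.
Proof.
move=> t0.
pose bad (x : seq {set torus}) := ~~ all (fun S : {set torus} => (#|S| <= 1)%N) x.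
pose B m := [set w | bad (mesh_history N (t / m.+1%:R) m.+1 w)].
have h0 m : 0 < t / m.+1%:R by rewrite divr_gt0 // ltr0n.
have BE m : B m = (fun w => (bad (mesh_history N (t / m.+1%:R) m.+1 w))%:R : R)
    @^-1` [set 1].
  apply/seteqP; split => w /=; rewrite /B /=; first by move=> ->.
  by case: (bad _) => // /eqP; rewrite eq_sym oner_eq0.
have mB m : measurable (B m).
  rewrite BE -[X in measurable X]setTI.
  have mf := measurable_of_mesh_history N (fun x => (bad x)%:R) m.+1 (h0 m).
  by apply: mf.
have PB m : (P (B m) <= ((#|torus| ^ 2)%:R * t ^+ 2 / m.+1%:R)%:E)%E.
  have -> : P (B m) =
      (\int[P]_w ((bad (mesh_history N (t / m.+1%:R) m.+1 w))%:R)%:E)%E.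
    rewrite -[B m]setIT -integral_indic //; apply: eq_integral => w _.
    rewrite indicE (_ : (w \in B m) = bad (mesh_history N (t / m.+1%:R) m.+1 w)) //.
    by apply/idP/idP; rewrite inE.
  rewrite (integral_mesh_history smoothing (F := fun x => (bad x)%:R)) //.
  rewrite lee_fin; apply: le_trans (crowded_mesh_mean t0 (ltn0Sn m)).
  have [q01 _ _] := ring_prob_bounds (ltW (h0 m)).
  apply: history_mean_le => // x; rewrite /bad.
  have [->|c1] := crowdedP (R := R) x; first exact: crowded_ge0.
  by apply: (le_trans _ c1); case: (all _ x).
have null : P.-negligible (\bigcap_m B m).
  exists (\bigcap_m B m); split => //; first exact: bigcapT_measurable.
  apply/eqP; rewrite eq_le measure_ge0 andbT.
  have fin : P (\bigcap_m B m) \is a fin_num.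
    by apply: fin_num_measure; exact: bigcapT_measurable.
  rewrite -(fineK fin) lee_fin.
  apply: (@le0_of_le_div_nat _ _ ((#|torus| ^ 2)%:R * t ^+ 2)) => -[//|m] _.
  rewrite -lee_fin (fineK fin); apply: le_trans (PB m).
  by apply: le_measure; rewrite ?inE //; [exact: bigcapT_measurable|exact: bigcap_inf].
apply: filterS2 ae_regular_path (_ : {ae P, forall w, ~ (\bigcap_m B m) w}).
  move=> w path; apply: contra_notP => /negP.
  rewrite -ltNge => big m _; apply/negP => good; move: big.
  rewrite ltNge; case/negP.
  by rewrite (total_of_history t0 (ltn0Sn m) path good) path_energy_le.
by apply: negligibleS null => w /= /contrapT.
Qed.

Lemma measurable_total t : measurable_fun setT (total t).
Proof.
apply: measurable_sum => i; apply: measurable_funX.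
rewrite /discrepancy /laplacian /nbr_avg; apply: measurable_funB => //.
apply: measurable_funM => //; under eq_fun do rewrite big_mkcond.
by apply: measurable_sum => j; case: (neighbors i j).
Qed.

(** When no mesh interval is crowded the process at time [t] is the chain. Both are
   bounded, so the expectations differ by at most a multiple of the mean number
   of crowded intervals, which vanishes with the mesh. *)
Lemma expected_energy (M : R -> torus * torus -> R) (t : R) : 0 < t ->
  M 0 = (fun x => (x.1 == 0)%:R * (x.2 == 0)%:R) -> flow moment_gen M ->
  'E_P[total t]%E = (energy M t)%:E.
Proof.
move=> t0 M0 Mf.
have [D D0 hD] := chain_energy_converges d_gt0 n_gt2 M0 Mf (ltW t0).
have C0 : 0 <= C by apply: sumr_ge0.
pose K := D + C * ((#|torus| ^ 2)%:R * t ^+ 2).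
have mtot : measurable_fun setT (fun w => (total t w)%:E).
  exact/measurable_EFinP/measurable_total.
have tot0 w : (0 <= (total t w)%:E)%E by rewrite lee_fin total_ge0.
rewrite unlock.
have bounds m : (0 < m)%N ->
    (\int[P]_w (total t w)%:E <= (energy M t + K / m%:R)%:E)%E /\
    ((energy M t)%:E <= \int[P]_w (total t w)%:E + (K / m%:R)%:E)%E.
  move=> m0; have mR : 0 < m%:R :> R by rewrite ltr0n.
  pose h := t / m%:R; have h0 : 0 < h by rewrite divr_gt0.
  pose q := 1 - expR (- h); have [q01 _ _] := ring_prob_bounds (ltW h0).
  have crowd0 x : 0 <= C * crowded (R := R) (I := torus) x.
    by rewrite mulr_ge0 // crowded_ge0.
  have FG0 x : 0 <= path_energy x + C * crowded x.
    by rewrite addr_ge0 // path_energy_ge0.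
  have mH (F : seq {set torus} -> R) :
      measurable_fun setT (fun w => (F (mesh_history N h m w))%:E).
    exact/measurable_EFinP/measurable_of_mesh_history.
  have cm := crowded_mesh_mean t0 m0; rewrite -/h -/q in cm.
  have := hD m m0; rewrite -/h -/q -/path_energy ler_norml => /andP[lo up].
  have cC : C * history_mean (I := torus) q m crowded <=
      C * ((#|torus| ^ 2)%:R * t ^+ 2) / m%:R.
    by rewrite -[leRHS]mulrA ler_wpM2l.
  split.
    apply: (@le_trans _ _ (\int[P]_w (path_energy (mesh_history N h m w) +
        C * crowded (mesh_history N h m w))%:E)%E).
      apply: ae_ge0_le_integral => //.
      - by move=> w _; rewrite lee_fin.
      - exact: (mH (fun x => path_energy x + C * crowded x)).
      apply: filterS2 ae_regular_path (ae_total_le t0) => w path totC _.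
      rewrite lee_fin; have [good|c1] := crowdedP (R := R) (mesh_history N h m w).
        by rewrite (total_of_history t0 m0 path good) lerDl.
      rewrite (le_trans totC) // -[C in leLHS]add0r lerD ?path_energy_ge0 //.
      by rewrite ler_peMr.
    rewrite (integral_mesh_history smoothing
      (F := fun x => path_energy x + C * crowded x)) //.
    rewrite lee_fin history_meanD -/q /K mulrDl; lra.
  apply: (@le_trans _ _ (\int[P]_w (path_energy (mesh_history N h m w))%:E +
      (D / m%:R)%:E)%E).
    rewrite (integral_mesh_history smoothing (F := path_energy)) //; last first.
      exact: path_energy_ge0.
    by rewrite -EFinD lee_fin -/q; lra.
  apply: (@le_trans _ _ (\int[P]_w (total t w)%:E +
      (C * history_mean (I := torus) q m crowded)%:E + (D / m%:R)%:E)%E); last first.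
    rewrite -addeA leeD2l // -EFinD lee_fin /K mulrDl; lra.
  rewrite leeD2r //.
  have <- : (\int[P]_w (C * crowded (mesh_history N h m w))%:E =
      (C * history_mean (I := torus) q m crowded)%:E)%E.
    rewrite (integral_mesh_history smoothing (F := fun x => C * crowded x)) //.
    congr (_%:E); rewrite /history_mean mulr_sumr.
    by apply: eq_bigr => x _; rewrite mulrCA.
  rewrite -ge0_integralD //; last 2 first.
  - by move=> w _; rewrite lee_fin.
  - exact: (mH (fun x => C * crowded x)).
  apply: ae_ge0_le_integral => //.
  - by move=> w _; rewrite lee_fin path_energy_ge0.
  - by move=> w _; rewrite adde_ge0 // lee_fin.
  - by apply: emeasurable_funD => //; exact: (mH (fun x => C * crowded x)).
  apply: filterS ae_regular_path => w path _.
  rewrite -EFinD lee_fin.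
  have [good|c1] := crowdedP (R := R) (mesh_history N h m w).
    by rewrite -(total_of_history t0 m0 path good) lerDl.
  apply: (le_trans (path_energy_le _)); rewrite -[C in leLHS]add0r lerD ?total_ge0 //.
  by rewrite ler_peMr.
have fin : (\int[P]_w (total t w)%:E)%E \is a fin_num.
  rewrite ge0_fin_numE ?integral_ge0 //.
  by have [le _] := bounds 1%N isT; rewrite (le_lt_trans le) // ltry.
rewrite -(fineK fin); congr (_%:E); set e := fine _.
have eE : (\int[P]_w (total t w)%:E)%E = e%:E by rewrite fineK.
apply/eqP; rewrite eq_le; apply/andP; split; rewrite -subr_le0;
  apply: (@le0_of_le_div_nat _ _ K) => m m0; have [b1 b2] := bounds m m0.
  by move: b1; rewrite eE lee_fin; lra.
by move: b2; rewrite eE -EFinD lee_fin; lra.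
Qed.

End ExpectedEnergy.

(** * The two-sided bound *)

(** The energy is a limit of means of sums of squares. *)
Lemma energy_ge0 (R : realType) (d n : nat) (M : R -> torus d n * torus d n -> R)
    (t : R) : (0 < d)%N -> (2 < n)%N ->
  M 0 = (fun x => (x.1 == 0)%:R * (x.2 == 0)%:R) -> flow moment_gen M -> 0 <= t ->
  0 <= energy M t.
Proof.
move=> d0 n2 M0 Mf t0.
have [D D0 hD] := chain_energy_converges d0 n2 M0 Mf t0.
rewrite -oppr_le0; apply: (@le0_of_le_div_nat _ _ D) => m m0.
have h0 : 0 <= t / m%:R by rewrite divr_ge0.
have [q01 _ _] := ring_prob_bounds h0.
have := hD m m0; rewrite ler_norml => /andP[_].
have : 0 <= history_mean (1 - expR (- (t / m%:R))) m
    (fun h => \sum_(i : torus d n) laplacian (smooth_path h) i ^+ 2).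
  by apply: history_mean_ge0 => // x; apply: sumr_ge0 => i _; exact: sqr_ge0.
lra.
Qed.

Lemma gap1_le (R : realType) (n : nat) : (4 <= n)%N -> gap1 n <= 32 / n%:R :> R.
Proof.
move=> n4; have nR : 4 <= n%:R :> R by rewrite ler_nat.
have n0 : 0 < n%:R :> R by lra.
have pi0 := pi_ge0 R; have pi4 := pi_le4 (R := R).
have y1 : pi / n%:R <= 1 :> R by rewrite ler_pdivrMr // mul1r (le_trans pi4).
have y0 : 0 <= pi / n%:R :> R by rewrite divr_ge0 // ltW.
rewrite /gap1 -mulrA; have y01 : 0 <= (pi / n%:R : R) <= 1 by rewrite y0.
apply: (le_trans (one_sub_cos_le y01)).
rewrite (_ : 32 / n%:R = 2 * (4 * (4 / n%:R))); last by ring.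
rewrite ler_wpM2l // expr2; apply: ler_pM => //; first by rewrite (le_trans y1) // ler1n.
by rewrite ler_pM2r // invr_gt0.
Qed.

Theorem lemma5p6 (R : realType) (d : nat) (beta2 : R)
  (d_gt0 : (0 < d)%N) (beta2_gt0 : 0 < beta2)
  (G_le : exists2 n1 : nat, (3 <= n1)%N &
    forall (n : nat) (t : R) (p : R -> torus d n -> R),
      odd n -> (n1 <= n)%N -> 4 * d%:R <= t -> is_heat_kernel p ->
      heat_energy p t <=
        beta2 / decay_scale d n t * expR (- (2 * gap1 n * d%:R^-1 * t))) :
  exists (theta1 theta2 : R) (n0 : nat),
    [/\ 0 < theta1, 0 < theta2, (3 <= n0)%N &
      forall (n : nat) (t : R) (dT : measure_display) (T : measurableType dT)
        (P : probability T R) (N : torus d n -> R -> {RV P >-> nat})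
        (Y : torus d n -> R -> {RV P >-> R}),
        odd n -> (n0 <= n)%N -> 4 * d%:R <= t ->
        smoothing_process N Y -> started_from_unit_mass Y ->
        ((theta1 / decay_scale d n t
            * expR (- (2 * gap1 n * d%:R^-1 * t)))%:E
          <= 'E_P[(fun w => \sum_(i : torus d n) discrepancy Y i t w ^+ 2)%R])%E
        /\ ('E_P[(fun w => \sum_(i : torus d n) discrepancy Y i t w ^+ 2)%R]
          <= (theta2 / decay_scale d n t
            * expR (- ((2 * gap1 n * d%:R^-1 - 4 * beta2 / n%:R ^+ (d + 4))
                       * t)))%:E)%E].
Proof.
have [n1 n1_ge3 G_le'] := G_le.
pose alpha : R := d%:R / 2 + 2.
pose A : R := Num.max (4 * d%:R) (32 * beta2 * (2 `^ alpha + 1)).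
have dR : 1 <= d%:R :> R by rewrite ler1n.
have A4d : 4 * d%:R <= A by rewrite le_max lexx.
have Alarge : 32 * beta2 * (2 `^ alpha + 1) <= A by rewrite le_max lexx orbT.
have A1 : 1 <= A by lra.
pose C1 : R := beta2 + 21 / 2 * beta2 * A.
pose C2 : R := 8 * expR (d%:R + 2) * (9 * (d%:R + 2) * A) `^ alpha.
have C1_gt0 : 0 < C1 by rewrite /C1 addr_gt0 // !mulr_gt0 // (lt_le_trans _ A1).
(* Since [b <= 64 / n], the condition [n >= 576 A] gives [b A <= 1/9]. *)
exists (energy_const R d), (Num.max C2 (19 * C1)),
  (maxn (maxn n1 16) (Num.truncn (576 * A)).+1).
split.
- exact: energy_const_gt0.
- by rewrite lt_max (@mulr_gt0 _ 19 C1) ?orbT.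
- by rewrite leq_max (leq_trans _ (leq_maxr _ _)).
move=> n t dT T P N Y n_odd n_ge t_ge smoothing start.
have [n_n1 n16 nA] : [/\ (n1 <= n)%N, (16 <= n)%N &
    ((Num.truncn (576 * A)).+1 <= n)%N].
  by move: n_ge; rewrite !geq_max => /andP[/andP[-> ->] ->].
have n2 : (2 < n)%N by apply: leq_trans n16.
have n0 : (0 < n)%N by apply: leq_trans n16.
have nR : 0 < n%:R :> R by rewrite ltr0n.
have t0 : 0 < t by lra.
have [p p0 pf] := flow_exists (fun i : torus d n => (i == 0)%:R : R)
  (@linop_laplacian R d n).
have [M M0 Mf] := flow_exists (fun x : torus d n * torus d n =>
  (x.1 == 0)%:R * (x.2 == 0)%:R : R) (@linop_moment_gen R d n).
rewrite (expected_energy d_gt0 n2 smoothing start t0 M0 Mf).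
have H0 s : 0 <= s -> 0 <= energy M s by exact: energy_ge0.
split; rewrite lee_fin.
  apply: (le_trans (heat_energy_lower_bound d_gt0 n16 t_ge p0 pf)).
  have [K [K0 Kt dK]] := energy_renewal n2 p0 pf M0 Mf t.
  have := increment_le (ltW t0) (fun s _ => is_derive_cst (0 : R) s 1)
    (fun s _ => dK s).
  rewrite subrr subr_ge0 K0 Kt; apply => s /andP[s0 _].
  by rewrite mulr_ge0 ?H0 // heat_energy_ge0.
have bA : 2 * gap1 n * d%:R^-1 * A <= 9^-1.
  have A0 : 0 <= 576 * A by lra.
  have /andP[_] := truncn_itv A0.
  move=> /lt_le_trans /(_ (_ : _ <= n%:R)) nA'.
  have {}nA' : 576 * A < n%:R by apply: nA'; rewrite ler_nat.
  have g := @gap1_le R n (leq_trans _ n16 : (4 <= n)%N).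
  have g0 : 0 <= gap1 n :> R by rewrite subr_ge0 cos_le1.
  apply: (@le_trans _ _ (2 * (32 / n%:R) * A)).
    rewrite ler_wpM2r //; first by lra.
    apply: (@le_trans _ _ (2 * gap1 n)).
      by rewrite ler_piMr ?mulr_ge0 // invf_le1 // (lt_le_trans _ dR).
    by rewrite ler_wpM2l // g.
  rewrite mulrA mulrAC ler_pdivrMr //; lra.
have b0 : 0 <= 2 * gap1 n * d%:R^-1 :> R.
  by rewrite !mulr_ge0 ?invr_ge0 // subr_ge0 cos_le1.
have t1 : 1 <= t by lra.
apply: (renewal_decay (G := heat_energy p) n0 beta2_gt0 b0 A1 Alarge bA H0
  _ _ _ _ _ _ t1).
- by move=> s; exact: energy_continuous.
- by move=> s; exact: heat_energy_ge0.
- by move=> s; exact: heat_energy_le4.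
- move=> s As; apply: G_le' => //; first exact: le_trans As.
  exact: flow_heat_kernel.
- exact: energy_renewal.
- exact: heat_energy_primitive.
Qed.
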